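(* Let $p>2$ and $B\geq 1$. Then there exist $K_1=K_1(p,B)$ and $K_2=K_2(p,B)$ depending only on $p$ and $B$ with the following property. Let $n\geq K_1$ and let $A$ be an $n\times n$ random matrix with i.i.d. columns $Y_1,\dots,Y_n$, where each $Y_i$ is a centered isotropic random vector in $\mathbb{R}^n$ satisfying $\sup_{a\in S^{n-1}}\mathbb{E}|\langle Y_i,a\rangle|^p\leq B$. Then $$\|A\|_{2\to 2}\leq K_2\max_{i\leq n}\|Y_i\|$$ with probability at least $1-\frac{4}{n}$.
   Context: A centered random vector $Y$ in $\mathbb{R}^n$ is isotropic if $\mathbb{E}YY^T=\mathrm{Id}_n$. $\|\cdot\|$ is the Euclidean norm and $\|\cdot\|_{2\to 2}$ the spectral norm. *)

(* Defs.v *)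
From HB Require Import structures.
From mathcomp Require Import all_boot all_order all_algebra.
From mathcomp Require Import all_classical all_reals all_analysis.
Set Implicit Arguments. Unset Strict Implicit. Unset Printing Implicit Defensive.
Import Order.TTheory GRing.Theory Num.Theory.
Local Open Scope classical_set_scope.
Local Open Scope ring_scope.

Definition enorm (R : realType) (n : nat) (x : 'cV[R]_n) : R :=
  Num.sqrt (\sum_(i < n) x i 0 ^+ 2).

Definition opnorm (R : realType) (m n : nat) (A : 'M[R]_(m, n)) : R :=
  sup [set enorm (A *m x) | x in [set x : 'cV[R]_n | enorm x = 1]].

(* a vector of R^n given as an n-tuple (the measurable space n.-tuple R,
   with the product = Borel sigma-algebra), viewed as a column vector *)
Definition tuple_cV (R : realType) (n : nat) (t : n.-tuple R) : 'cV[R]_n :=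
  \col_(j < n) tnth t j.

Definition cols_mx (R : realType) (n : nat) (Y : 'I_n -> n.-tuple R) : 'M[R]_n :=
  \matrix_(j < n, i < n) tnth (Y i) j.

Definition independent_family d (T : measurableType d) (R : realType)
  (P : probability T R) (I : finType) d' (U : measurableType d')
  (X : I -> T -> U) : Prop :=
  forall B : I -> set U, (forall i, measurable (B i)) ->
    fine (P (\bigcap_i (X i @^-1` B i))) = \prod_(i : I) fine (P (X i @^-1` B i)).

Definition identically_distributed d (T : measurableType d) (R : realType)
  (P : probability T R) (I : Type) d' (U : measurableType d')
  (X : I -> T -> U) : Prop :=
  forall i j (B : set U), measurable B -> P (X i @^-1` B) = P (X j @^-1` B).

(* Main.v *)
(* Write A z for the combination of the columns with coefficients z, f for the squared norm of A and
   M >= n / 2 for the largest squared column length.  It is enough to show |A x|^2 <= f / 2 + C M.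

   Spreading: with high probability, for every dyadic l <= n and every integer vector N with at most
   c l nonzero entries and moderate length, fewer than l of the columns outside the support of N have
   a squared inner product with A N / |A N| above K (n / l)^(1 - eps).  For fixed N the columns outside
   the support are independent of A N, so the product of the 1 + (l / n) |<Y_i, A N / |A N|>|^p has
   expectation at most e^(B l), whereas l large inner products make it at least (K' (n / l)^eps')^l;
   this beats the number of vectors N, because p > 2.

   Flat vectors: if |z_i| <= 1 on a support of size k, replace z by a random sign vector of mean q z.
   Its support is so small that spreading applies to it, and its combination has nearly q times the
   inner products of A z with the columns.  Expanding |A z|^2 over the columns gives
   |A z|^2 <= k (eps f + C M).

   Peeling: order the coordinates of x by size.  From a set S of at most 2^u coordinates keep the few
   largest, H, and the few columns having a large inner product with A x_H.  The discarded coordinates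
   interact weakly with H (by spreading, with a bound summable over u), while their interaction with the
   other kept ones is part of the energy of the flat vector supported on S minus H.  The contributions
   of the flat vectors are summable over u by Cauchy condensation, so no logarithm is lost. *)
Require Import Defs.
From HB Require Import structures.
From mathcomp Require Import all_boot all_order all_algebra.
From mathcomp Require Import all_reals.
From mathcomp Require Import ring lra zify.
Set Implicit Arguments.
Unset Strict Implicit.
Unset Printing Implicit Defensive.
Import Order.TTheory GRing.Theory Num.Theory.
Local Open Scope ring_scope.

(** * Rounding to sparse vectors *)

Section Sampling.
Context (R : realFieldType) (n m : nat) (b : 'I_n -> 'I_m -> R) (q c : 'I_n -> R).
Context (q01 : forall j, 0 <= q j <= 1).

(** Averaging [x = true] with weight [p] and [x = false] with weight [1 - p] cancels the terms
    linear in [x - p] and leaves the variance [p * (1 - p) <= p]; one of the two values is at most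
    the average. *)
Lemma rounding_step (r v : 'I_m -> R) (p e : R) : 0 <= p <= 1 ->
  exists x : bool,
    \sum_i (r i + v i * (x%:R - p)) ^+ 2 + e * (x%:R - p)
      <= \sum_i r i ^+ 2 + p * \sum_i v i ^+ 2.
Proof.
move=> /andP[p0 p1].
pose W (x : bool) := \sum_i (r i + v i * (x%:R - p)) ^+ 2 + e * (x%:R - p).
have WE x : W x = \sum_i r i ^+ 2 + 2 * (x%:R - p) * (\sum_i r i * v i)
   + (x%:R - p) ^+ 2 * \sum_i v i ^+ 2 + e * (x%:R - p).
  rewrite /W; congr (_ + _); rewrite !mulr_sumr -!big_split /=.
  by apply: eq_bigr => i _; ring.
have v0 : 0 <= \sum_i v i ^+ 2 by apply: sumr_ge0 => i _; exact: sqr_ge0.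
have avg : p * W true + (1 - p) * W false <= \sum_i r i ^+ 2 + p * \sum_i v i ^+ 2.
  rewrite !WE /=.
  have := mulr_ge0 (mulr_ge0 p0 p0) v0.
  by move: (\sum_i v i ^+ 2) (\sum_i r i * v i) (\sum_i r i ^+ 2) => A B C; nra.
have [h|h] := leP (W true) (W false).
  exists true; rewrite -/(W true); apply: le_trans avg; nra.
exists false; rewrite -/(W false); apply: le_trans avg; nra.
Qed.

(** Method of conditional expectations: the coordinates are fixed one by one, and [r] accumulates
    the deviations already fixed. *)
Lemma rounding_seq (s : seq 'I_n) (r : 'I_m -> R) : uniq s ->
  exists x : 'I_n -> bool,
    \sum_i (r i + \sum_(j <- s) b j i * ((x j)%:R - q j)) ^+ 2
      + \sum_(j <- s) c j * ((x j)%:R - q j)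
    <= \sum_i r i ^+ 2 + \sum_(j <- s) q j * \sum_i b j i ^+ 2.
Proof.
elim: s r => [|j s IHs] r /=.
  move=> _; exists (fun=> false); rewrite !big_nil !addr0 le_eqVlt; apply/orP; left.
  by apply/eqP; apply: eq_bigr => i _; rewrite big_nil addr0.
move=> /andP[js us].
have [y hy] := rounding_step r (b j) (c j) (q01 j).
have [x hx] := IHs (fun i => r i + b j i * (y%:R - q j)) us.
exists (fun k => if k == j then y else x k).
have notj k : k \in s -> (k == j) = false.
  by move=> ks; apply: contraNF js => /eqP <-.
have E (F : 'I_n -> R -> R) :
    \sum_(k <- s) F k (if k == j then y else x k)%:R = \sum_(k <- s) F k (x k)%:R.
  by apply: eq_big_seq => k ks; rewrite notj.
rewrite !big_cons eqxx.
rewrite (E (fun k t => c k * (t - q k))).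
under eq_bigr do rewrite big_cons eqxx (E (fun k t => b k _ * (t - q k))) addrA.
move: hx hy; lra.
Qed.

(* The right-hand side is the mean of the left-hand side when the [x j] are independent Bernoulli
   variables with mean [q j], up to the factors [1 - q j] of the variances. *)
Lemma rounding : exists x : 'I_n -> bool,
    \sum_i (\sum_j b j i * ((x j)%:R - q j)) ^+ 2 + \sum_j c j * ((x j)%:R - q j)
    <= \sum_j q j * \sum_i b j i ^+ 2.
Proof.
have [x] := rounding_seq (fun=> 0) (index_enum_uniq 'I_n).
rewrite [X in _ <= X + _ -> _]big1 ?add0r; last by move=> i _; rewrite expr0n.
move=> hx; exists x; apply: le_trans hx; rewrite lerD2r le_eqVlt; apply/orP; left.
by apply/eqP; apply: eq_bigr => i _; rewrite add0r.
Qed.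

End Sampling.

(** * Energy of flat vectors *)

Definition dotp (R : realFieldType) (d : nat) (u v : 'I_d -> R) : R := \sum_j u j * v j.

Definition comb (R : realFieldType) (n d : nat) (Y : 'I_n -> 'I_d -> R) (z : 'I_n -> R) : 'I_d -> R :=
  fun j => \sum_i z i * Y i j.

(* [w] is not normalised, so that the strict inequality never holds when [w = 0]. *)
Definition spread (R : realFieldType) (n d : nat) (Y : 'I_n -> 'I_d -> R) (a l : nat) (b s : R) :=
  forall N : 'I_n -> int,
    (#|[set i | N i != 0]| <= a)%N -> \sum_i (N i)%:~R ^+ 2 <= b ->
    let w := comb Y (fun i => (N i)%:~R) in
    (#|[set i | (N i == 0) && (s * dotp w w < dotp (Y i) w ^+ 2)%R]| < l)%N.

Section Dot.
Context (R : realFieldType).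

Lemma dotpC d (u v : 'I_d -> R) : dotp u v = dotp v u.
Proof. by apply: eq_bigr => j _; rewrite mulrC. Qed.

Lemma dotp_ge0 d (u : 'I_d -> R) : 0 <= dotp u u.
Proof. by apply: sumr_ge0 => j _; rewrite -expr2 sqr_ge0. Qed.

Lemma dotpDr d (u v w : 'I_d -> R) : dotp u (fun j => v j + w j) = dotp u v + dotp u w.
Proof. by rewrite /dotp -big_split; apply: eq_bigr => j _; rewrite mulrDr. Qed.

Lemma dotpDl d (u v w : 'I_d -> R) : dotp (fun j => v j + w j) u = dotp v u + dotp w u.
Proof. by rewrite dotpC dotpDr !(dotpC u). Qed.

Lemma eq_dotp d (u v u' v' : 'I_d -> R) : u =1 u' -> v =1 v' -> dotp u v = dotp u' v'.
Proof. by move=> e e'; apply: eq_bigr => j _; rewrite e e'. Qed.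

Lemma sqr_dotp d (u : 'I_d -> R) : dotp u u = \sum_j u j ^+ 2.
Proof. by apply: eq_bigr => j _; rewrite expr2. Qed.

Lemma dotp_comb n d (Y : 'I_n -> 'I_d -> R) z u : dotp u (comb Y z) = \sum_i z i * dotp u (Y i).
Proof.
rewrite /dotp /comb; under eq_bigr do rewrite mulr_sumr.
rewrite exchange_big; apply: eq_bigr => i _; rewrite mulr_sumr.
by apply: eq_bigr => j _; ring.
Qed.

Lemma dotp_comb_comb n d (Y : 'I_n -> 'I_d -> R) z z' :
  dotp (comb Y z) (comb Y z') = \sum_i z i * dotp (Y i) (comb Y z').
Proof. by rewrite dotpC dotp_comb; apply: eq_bigr => i _; rewrite dotpC. Qed.

Lemma eq_comb n d (Y : 'I_n -> 'I_d -> R) z z' : z =1 z' -> comb Y z =1 comb Y z'.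
Proof. by move=> e j; apply: eq_bigr => i _; rewrite e. Qed.

Lemma combD n d (Y : 'I_n -> 'I_d -> R) z z' :
  comb Y (fun i => z i + z' i) =1 (fun j => comb Y z j + comb Y z' j).
Proof. by move=> j; rewrite /comb -big_split; apply: eq_bigr => i _; rewrite mulrDl. Qed.

Lemma combZ n d (Y : 'I_n -> 'I_d -> R) t z :
  comb Y (fun i => t * z i) =1 (fun j => t * comb Y z j).
Proof. by move=> j; rewrite /comb mulr_sumr; apply: eq_bigr => i _; rewrite mulrA. Qed.

Lemma dotpZr d t (u v : 'I_d -> R) : dotp u (fun j => t * v j) = t * dotp u v.
Proof. by rewrite /dotp mulr_sumr; apply: eq_bigr => j _; ring. Qed.

Lemma dotpZl d t (u v : 'I_d -> R) : dotp (fun j => t * u j) v = t * dotp u v.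
Proof. by rewrite dotpC dotpZr dotpC. Qed.

Lemma amgm (t x y : R) : 0 < t -> 2 * (x * y) <= t * x ^+ 2 + y ^+ 2 / t.
Proof.
move=> t0; have e : t * x ^+ 2 + y ^+ 2 / t - 2 * (x * y) = (t * x - y) ^+ 2 / t by field; rewrite gt_eqF.
by rewrite -subr_ge0 e divr_ge0 ?sqr_ge0 ?ltW.
Qed.

Lemma amgm_sum (I : finType) (P : pred I) (t : R) (x y : I -> R) : 0 < t ->
  2 * \sum_(i | P i) x i * y i
    <= t * \sum_(i | P i) x i ^+ 2 + (\sum_(i | P i) y i ^+ 2) / t.
Proof.
move=> t0; rewrite !mulr_sumr mulr_suml -big_split /=.
by apply: ler_sum => i _; apply: amgm.
Qed.

Lemma sum_sub_sqr (I : finType) (P : pred I) (x : I -> R) :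
  \sum_(i | P i) x i ^+ 2 <= \sum_i x i ^+ 2.
Proof.
rewrite [leRHS](bigID P) /= lerDl; apply: sumr_ge0 => i _; exact: sqr_ge0.
Qed.

Lemma sum_card_le (I : finType) (P : pred I) (x : I -> R) (c : R) :
  (forall i, P i -> x i <= c) -> \sum_(i | P i) x i <= #|P|%:R * c.
Proof.
move=> h; apply: le_trans (ler_sum _ h) _.
by rewrite sumr_const mulr_natl.
Qed.

End Dot.

Section Near.
Context (R : realFieldType) (n d : nat) (Y : 'I_n -> 'I_d -> R) (f M : R).
Context (f0 : 0 < f) (M0 : 0 < M).
Context (F1 : forall z, dotp (comb Y z) (comb Y z) <= f * dotp z z).
Context (F2 : forall w, \sum_i dotp (Y i) w ^+ 2 <= f * dotp w w).
Context (YM : forall i, dotp (Y i) (Y i) <= M).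

Lemma sum_flat (I : {set 'I_n}) (k : nat) (z : 'I_n -> R) :
  (#|I| <= k)%N -> (forall i, `|z i| <= 1) -> (forall i, i \notin I -> z i = 0) ->
  \sum_i `|z i| <= k%:R.
Proof.
move=> Ik z1 zI; rewrite (bigID (mem I)) /= [X in _ + X]big1 ?addr0; last first.
  by move=> i /zI ->; rewrite normr0.
apply: le_trans (sum_card_le (c := 1) _) _; first by move=> i _; exact: z1.
by rewrite mulr1 ler_nat.
Qed.

(* [N] plays the role of a random sparse sign vector with mean [q z]. *)
Lemma sparsify (I : {set 'I_n}) (k : nat) (z : 'I_n -> R) (q : R) :
  (#|I| <= k)%N -> (forall i, `|z i| <= 1) -> (forall i, i \notin I -> z i = 0) ->
  0 < q <= 1 ->
  exists N : 'I_n -> int,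
    [/\ forall i, N i != 0 -> (N i)%:~R ^+ 2 = 1 :> R,
        #|[set i | N i != 0]|%:R <= 2 * q * k%:R &
        \sum_i (dotp (Y i) (comb Y (fun i => (N i)%:~R)) - q * dotp (Y i) (comb Y z)) ^+ 2
          <= 2 * q * k%:R * f * M].
Proof.
move=> Ik z1 zI /andP[q0 q1].
have sz := sum_flat Ik z1 zI.
have q01 j : 0 <= q * `|z j| <= 1.
  have := z1 j; have := normr_ge0 (z j); move: `|z j| => t; nra.
(* The linear term of weight [f * M] charges the number of selected coordinates in the same
   inequality as the deviations, so that a single [x] controls both. *)
have [x hx] := rounding (fun j i => Num.sg (z j) * dotp (Y i) (Y j)) (fun=> f * M) q01.
pose N i : int := if x i then sgz (z i) else 0.
have NE i : (N i)%:~R = Num.sg (z i) * (x i)%:R :> R.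
  by rewrite /N; case: (x i); rewrite ?mulr1 ?mulr0 // sgrEz.
have sg1 i : Num.sg (z i) ^+ 2 <= 1 by rewrite sqr_sg; case: (_ != _).
have rhs : \sum_j q * `|z j| * \sum_i (Num.sg (z j) * dotp (Y i) (Y j)) ^+ 2 <= q * k%:R * f * M.
  apply: le_trans (_ : \sum_j q * `|z j| * (f * M) <= _); last first.
    rewrite -mulr_suml -mulr_sumr -!mulrA ler_pM2l //.
    by rewrite ler_pM2r // mulr_gt0.
  apply: ler_sum => j _; apply: ler_wpM2l; first by case/andP: (q01 j).
  under eq_bigr do rewrite exprMn.
  rewrite -mulr_sumr; apply: le_trans (_ : 1 * \sum_i dotp (Y i) (Y j) ^+ 2 <= _).
    by apply: ler_wpM2r => //; apply: sumr_ge0 => i _; exact: sqr_ge0.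
  by rewrite mul1r (le_trans (F2 _)) // ler_pM2l.
have S1 : \sum_i (dotp (Y i) (comb Y (fun i => (N i)%:~R)) - q * dotp (Y i) (comb Y z)) ^+ 2 =
    \sum_i (\sum_j Num.sg (z j) * dotp (Y i) (Y j) * ((x j)%:R - q * `|z j|)) ^+ 2.
  apply: eq_bigr => i _; congr (_ ^+ 2); rewrite !dotp_comb mulr_sumr -sumrB.
  apply: eq_bigr => j _; rewrite NE.
  suff -> : q * (z j * dotp (Y i) (Y j)) = q * (Num.sg (z j) * `|z j| * dotp (Y i) (Y j)) by ring.
  by rewrite -numEsg.
have P1 : 0 <= \sum_i (dotp (Y i) (comb Y (fun i => (N i)%:~R)) - q * dotp (Y i) (comb Y z)) ^+ 2.
  by apply: sumr_ge0 => i _; exact: sqr_ge0.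
have S2 : \sum_(j < n) f * M * ((x j)%:R - q * `|z j|)
    = f * M * (\sum_j (x j)%:R) - f * M * (q * \sum_j `|z j|).
  by rewrite -mulr_sumr -mulrBr sumrB mulr_sumr.
have fM : 0 < f * M by rewrite mulr_gt0.
have xs0 : 0 <= \sum_(j < n) (x j)%:R :> R by apply: sumr_ge0 => i _; rewrite ler0n.
have K : f * M * (q * \sum_j `|z j|) <= q * k%:R * f * M.
  by rewrite mulrC -!mulrA ler_pM2l // ler_pM2r.
have {hx} := le_trans hx rhs; rewrite -S1 S2 => hx.
exists N; split.
- move=> i; rewrite NE /N; case: (x i); rewrite ?eqxx // mulr1 sqr_sg sgz_eq0 => -> //.
- apply: le_trans (_ : \sum_(j < n) (x j)%:R <= _).
    rewrite -sum1_card natr_sum big_mkcond /=; apply: ler_sum => i _.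
    rewrite inE /N; case: (x i) => //=.
    by case: ifP.
  rewrite -(ler_pM2l fM); lra.
- have : 0 <= f * M * \sum_(j < n) (x j)%:R by rewrite mulr_ge0 // ltW.
  lra.
Qed.

(** [P] collects the support of [N] and the columns with a large inner product with the sparse
    combination. On [P] the arithmetic-geometric inequality suffices because [P] is small. Off [P],
    [q * h i] is replaced by [h' i] at the cost given by [sparsify], and [h' i] is small by
    spreading. *)
Lemma flat_energy (I : {set 'I_n}) (k a l : nat) (z : 'I_n -> R) (q kap b s : R) :
  (#|I| <= k)%N -> (forall i, `|z i| <= 1) -> (forall i, i \notin I -> z i = 0) ->
  0 < q <= 1 -> 0 < kap -> 0 <= s -> 2 * q * k%:R <= a%:R -> a%:R <= b ->
  spread Y a l b s ->
  dotp (comb Y z) (comb Y z) <= (a + l)%:R * f + 2 * kap * f * k%:R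
     + 2 * k%:R * M / (kap * q) + 2 * k%:R ^+ 2 * s / (kap * q).
Proof.
move=> Ik z1 zI q01 kap0 s0 qka ab sp.
have /andP[q0 _] := q01.
have [N [N1 cN dev]] := sparsify Ik z1 zI q01.
pose h i := dotp (Y i) (comb Y z).
pose h' i := dotp (Y i) (comb Y (fun i => (N i)%:~R)).
pose Top := [set i | (N i == 0) && (s * dotp (comb Y (fun i => (N i)%:~R)) (comb Y (fun i => (N i)%:~R)) < h' i ^+ 2)].
pose P := [set i | N i != 0] :|: Top.
have NS : \sum_i (N i)%:~R ^+ 2 = #|[set i | N i != 0]|%:R :> R.
  rewrite -sum1_card natr_sum [RHS]big_mkcond; apply: eq_bigr => i _; rewrite inE.
  by case: eqVneq => [->|/N1 //]; rewrite expr0n.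
have cNa : (#|[set i | N i != 0]| <= a)%N.
  by rewrite -(ler_nat R) (le_trans cN).
have cP : (#|P| <= a + l)%N.
  rewrite cardsU; apply: leq_trans (leq_subr _ _) _; apply: leq_add => //.
  by apply/ltnW/sp => //; rewrite NS (le_trans _ ab) // ler_nat.
have Nk : \sum_i (N i)%:~R ^+ 2 <= 2 * q * k%:R :> R by rewrite NS.
set S := dotp _ _.
have SE : S = \sum_i z i * h i by exact: dotp_comb_comb.
have zz : \sum_i z i ^+ 2 <= k%:R.
  apply: le_trans (sum_flat Ik z1 zI); apply: ler_sum => i _.
  by rewrite -(real_normK (num_real (z i))) expr2 ler_piMl.
have hS : \sum_i h i ^+ 2 <= f * S by exact: F2.
have k0 : 0 <= k%:R :> R by rewrite ler0n.
(* The weight [f] makes the second term at most [S], which is absorbed by half of [2 * S]. *)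
have A1 : 2 * \sum_(i in P) z i * h i <= f * (a + l)%:R + S.
  apply: le_trans (amgm_sum _ _ _ f0) _; apply: lerD.
    rewrite ler_pM2l //; apply: le_trans (sum_card_le (c := 1) _) _; last first.
      by rewrite mulr1 ler_nat.
    move=> i _; rewrite -(real_normK (num_real (z i))).
    by rewrite -[X in _ <= X](expr1n _ 2) lerXn2r // ?nnegrE ?normr_ge0.
  rewrite ler_pdivrMr // mulrC; apply: le_trans hS; exact: sum_sub_sqr.
(* With this weight each of the two sums off [P] costs [kap * f * k] after division by [q]. *)
pose t := kap * q * f.
have t0 : 0 < t by rewrite !mulr_gt0.
have A2 : 2 * \sum_(i | i \notin P) z i * (q * h i - h' i) <= t * k%:R + 2 * k%:R * M / kap.
  apply: le_trans (amgm_sum _ _ _ t0) _; apply: lerD.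
    by rewrite ler_pM2l // (le_trans (sum_sub_sqr _ _)).
  rewrite ler_pdivrMr //.
  have -> : 2 * k%:R * M / kap * t = 2 * q * k%:R * f * M by rewrite /t; field; rewrite gt_eqF.
  apply: le_trans dev; apply: le_trans (sum_sub_sqr _ _) _.
  by apply: ler_sum => i _; rewrite -sqrrN opprB.
have A3 : 2 * \sum_(i | i \notin P) z i * h' i <= t * k%:R + 2 * k%:R ^+ 2 * s / kap.
  have -> : \sum_(i | i \notin P) z i * h' i = \sum_(i | (i \notin P) && (i \in I)) z i * h' i.
    rewrite [LHS](bigID (mem I)) /= [X in _ + X]big1 ?addr0 // => i /andP[_ /zI ->].
    by rewrite mul0r.
  apply: le_trans (amgm_sum _ _ _ t0) _; apply: lerD.
    by rewrite ler_pM2l // (le_trans (sum_sub_sqr _ _)).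
  rewrite ler_pdivrMr //.
  have -> : 2 * k%:R ^+ 2 * s / kap * t = k%:R * (s * (f * (2 * q * k%:R))).
    by rewrite /t; field; rewrite gt_eqF.
  apply: le_trans (sum_card_le (c := s * (f * (2 * q * k%:R))) _) _.
    move=> i /andP[]; rewrite !inE negb_or negbK => /andP[/eqP Ni]; rewrite Ni eqxx /= -leNgt => hi _.
    apply: le_trans hi _; apply: ler_wpM2l => //; apply: le_trans (F1 _) _.
    by rewrite ler_pM2l // sqr_dotp.
  apply: ler_wpM2r.
    by rewrite !mulr_ge0 // ltW.
  rewrite ler_nat; apply: leq_trans Ik; apply: subset_leq_card; apply/subsetP => i.
  by case/andP.
have split : q * S = q * (\sum_(i in P) z i * h i)
     + \sum_(i | i \notin P) z i * (q * h i - h' i) + \sum_(i | i \notin P) z i * h' i.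
  rewrite -addrA -big_split /= SE (bigID (mem P)) /= mulrDr; congr (_ + _).
  by rewrite mulr_sumr; apply: eq_bigr => i _; ring.
have key : q * S <= q * ((a + l)%:R * f + 2 * kap * f * k%:R
     + 2 * k%:R * M / (kap * q) + 2 * k%:R ^+ 2 * s / (kap * q)).
  have -> : q * ((a + l)%:R * f + 2 * kap * f * k%:R
     + 2 * k%:R * M / (kap * q) + 2 * k%:R ^+ 2 * s / (kap * q)) =
     q * ((a + l)%:R * f) + 2 * (t * k%:R) + 2 * k%:R * M / kap + 2 * k%:R ^+ 2 * s / kap.
    by rewrite /t; field; rewrite !gt_eqF.
  have := ler_wpM2l (ltW q0) A1; rewrite !mulrDr.
  move: split A2 A3; lra.
by rewrite ler_pM2l in key.
Qed.

End Near.

(** * Peeling off large coordinates *)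

Definition restr (R : realFieldType) (n : nat) (x : 'I_n -> R) (S : {set 'I_n}) : 'I_n -> R :=
  fun i => if i \in S then x i else 0.

Section Restr.
Context (R : realFieldType) (n d : nat) (Y : 'I_n -> 'I_d -> R) (x : 'I_n -> R).

Lemma sum_restr (S : {set 'I_n}) (F : 'I_n -> R) :
  \sum_i restr x S i * F i = \sum_(i in S) x i * F i.
Proof.
rewrite [RHS]big_mkcond; apply: eq_bigr => i _; rewrite /restr.
by case: ifP => // _; rewrite mul0r.
Qed.

Lemma restrU (S T : {set 'I_n}) : [disjoint S & T] ->
  comb Y (restr x (S :|: T)) =1 (fun j => comb Y (restr x S) j + comb Y (restr x T) j).
Proof.
move=> dST j; rewrite -combD; apply: eq_comb => i; rewrite /restr inE.
case: (boolP (i \in S)) => iS /=; last by rewrite add0r.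
by rewrite (disjointFr dST iS) addr0.
Qed.

Lemma energyU (S T : {set 'I_n}) : [disjoint S & T] ->
  dotp (comb Y (restr x (S :|: T))) (comb Y (restr x (S :|: T))) =
  dotp (comb Y (restr x S)) (comb Y (restr x S)) +
  2 * dotp (comb Y (restr x T)) (comb Y (restr x S)) +
  dotp (comb Y (restr x T)) (comb Y (restr x T)).
Proof.
move=> dST; rewrite (eq_dotp (restrU dST) (restrU dST)) dotpDr !dotpDl.
by rewrite (dotpC (comb Y (restr x S)) (comb Y (restr x T))); ring.
Qed.

End Restr.

Section Peel.
Context (R : archiRealFieldType) (n d : nat) (Y : 'I_n -> 'I_d -> R) (f : R).
Context (f0 : 0 < f).
Context (F1 : forall z, dotp (comb Y z) (comb Y z) <= f * dotp z z).
Context (F2 : forall w, \sum_i dotp (Y i) w ^+ 2 <= f * dotp w w).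

(** Rounding towards zero: the multiple of [eta] never exceeds [t] in absolute value, so that the
    integer vector inherits a bound on its length. *)
Lemma grid_approx (t eta : R) : 0 < eta -> exists m : int,
  (eta * m%:~R) ^+ 2 <= t ^+ 2 /\ (t - eta * m%:~R) ^+ 2 <= eta ^+ 2.
Proof.
move=> e0; pose k := Num.truncn (`|t| / eta).
have kl : k%:R * eta <= `|t|.
  by rewrite -ler_pdivlMr // truncn_le // divr_ge0 ?normr_ge0 // ltW.
have ku : `|t| <= (k%:R + 1) * eta.
  by rewrite -ler_pdivrMr // -[1]/(1%:R) -natrD addn1 ltW // truncnS_gt // divr_ge0 // ltW.
have k0 : 0 <= k%:R * eta by rewrite mulr_ge0 // ltW.
have A : (eta * k%:R) ^+ 2 <= `|t| ^+ 2.
  by rewrite lerXn2r ?nnegrE ?normr_ge0 // mulrC.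
have B : (`|t| - eta * k%:R) ^+ 2 <= eta ^+ 2.
  by rewrite lerXn2r ?nnegrE ?(ltW e0) //; move: kl ku; lra.
have [t0|t0] := leP 0 t.
  by exists k; rewrite -pmulrn; move: A B; rewrite ger0_norm.
exists (- k%:Z); rewrite mulrNz -pmulrn; move: A B; rewrite ltr0_norm //.
by rewrite mulrN sqrrN opprK -(sqrrN (t + _)) opprD sqrrN.
Qed.

(** Comparing the energies of [S] and of [S :\: H] leaves only the interaction of the discarded
    coordinates with [H], while [S :\: H] carries a flat vector of height [beta]. The term with
    [2 * om * f] telescopes when the step is iterated. *)
Lemma peel_step (x : 'I_n -> R) (S H : {set 'I_n}) (k a l : nat) (b s beta Phi eta om : R) :
  \sum_i x i ^+ 2 <= 1 ->
  (#|S| <= k)%N -> H \subset S -> (#|H| <= a)%N ->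
  (forall i, i \in S :\: H -> `|x i| <= beta) ->
  (forall (z : 'I_n -> R), (forall i, `|z i| <= 1) -> (forall i, i \notin S -> z i = 0) ->
    dotp (comb Y z) (comb Y z) <= k%:R * Phi) ->
  spread Y a l b s -> 0 <= s -> 0 < eta -> 1 <= b * eta ^+ 2 -> 0 < om ->
  exists S' : {set 'I_n}, [/\ S' \subset S, (#|S'| <= a + l)%N &
    dotp (comb Y (restr x S)) (comb Y (restr x S)) <=
    dotp (comb Y (restr x S')) (comb Y (restr x S')) + beta ^+ 2 * (k%:R * Phi)
    + 2 * om * f * (\sum_(i in S) x i ^+ 2 - \sum_(i in S') x i ^+ 2)
    + f * a%:R * eta ^+ 2 / om + k%:R * s / om].
Proof.
move=> x1 Sk HS Ha xb near sp s0 e0 be om0.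
have [N0 hN0] := fin_all_exists (fun i => grid_approx (x i) e0).
pose N i : int := if i \in H then N0 i else 0.
pose NR i : R := (N i)%:~R.
pose w := comb Y NR.
pose e i := restr x H i - eta * NR i.
have supN i : i \notin H -> N i = 0 by rewrite /N => /negbTE ->.
have Nx i : (eta * NR i) ^+ 2 <= x i ^+ 2.
  rewrite /NR /N; case: ifP => _; first by case: (hN0 i).
  by rewrite mulr0 expr0n sqr_ge0.
have ee : dotp e e <= a%:R * eta ^+ 2.
  rewrite sqr_dotp (bigID (mem H)) /= [X in _ + X]big1 ?addr0; last first.
    by move=> i iH; rewrite /e /restr /NR (negbTE iH) supN // mulr0 subr0 expr0n.
  apply: le_trans (sum_card_le (c := eta ^+ 2) _) _.
    by move=> i iH; rewrite /e /restr /NR /N iH; case: (hN0 i).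
  by rewrite ler_wpM2r ?sqr_ge0 // ler_nat.
have NN : eta ^+ 2 * \sum_i NR i ^+ 2 <= 1.
  rewrite mulr_sumr; apply: le_trans x1; apply: ler_sum => i _.
  by rewrite -exprMn.
have Nb : \sum_i NR i ^+ 2 <= b.
  by rewrite -(ler_pM2r (exprn_gt0 2 e0)) mulrC (le_trans NN).
have suppN : [set i | N i != 0] \subset H.
  by apply/subsetP => i; rewrite inE; apply: contraR => /supN ->.
have Na : (#|[set i | N i != 0]| <= a)%N by apply: leq_trans Ha; exact: subset_leq_card.
have := sp N Na Nb; rewrite -/w => Tl.
pose Top := [set i in S :\: H | s * dotp w w < dotp (Y i) w ^+ 2].
pose S' := H :|: Top.
pose lo := S :\: S'.
have TS : Top \subset S :\: H by apply/subsetP => i; rewrite inE => /andP[].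
have S'S : S' \subset S by rewrite subUset HS (subset_trans TS) // subsetDl.
have dl (T' : {set 'I_n}) : T' \subset S' -> [disjoint T' & lo].
  by move=> h; rewrite /lo disjoints_subset; apply: subset_trans h _; rewrite setCD subsetUr.
have dHT : [disjoint H & Top].
  by rewrite disjoint_sym disjoints_subset; apply: subset_trans TS _; rewrite setDE subsetIr.
have SE : S = S' :|: lo by rewrite /lo setDE setUIr setUCr setIT; apply/esym/setUidPr.
have SHE : S :\: H = Top :|: lo.
  apply/setP => i; rewrite !inE; have := subsetP HS i; have := subsetP TS i; rewrite !inE.
  by case: (i \in S); case: (i \in H) => //=; case: (_ < _).
pose Q (T' : {set 'I_n}) := dotp (comb Y (restr x T')) (comb Y (restr x T')).
pose C (T' : {set 'I_n}) := dotp (comb Y (restr x lo)) (comb Y (restr x T')).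
(* The interaction of [lo] with [Top] and the energy of [lo] occur in both expansions and cancel;
   [Q Top] has a favourable sign. *)
have Q1 : Q S = Q S' + 2 * C S' + Q lo by rewrite {1}SE /Q energyU // dl.
have Q2 : Q (S :\: H) = Q Top + 2 * C Top + Q lo by rewrite SHE /Q energyU // dl // subsetUr.
have Q3 : C S' = C H + C Top by rewrite /C (eq_dotp (fun=> erefl) (restrU _ _ dHT)) dotpDr.
have Q4 : 0 <= Q Top by exact: dotp_ge0.
have nearSH : Q (S :\: H) <= beta ^+ 2 * (k%:R * Phi).
  have [b0|b0] := ltP 0 beta; last first.
    have z i : restr x (S :\: H) i = 0.
      rewrite /restr; case: ifP => // /xb h; apply/eqP; rewrite -normr_le0.
      exact: le_trans b0.
    have -> : Q (S :\: H) = 0.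
      rewrite /Q dotp_comb_comb big1 // => i _; by rewrite z mul0r.
    by rewrite mulr_ge0 ?sqr_ge0 //; apply: le_trans (near (fun=> 0) _ _); rewrite ?dotp_ge0 // => i; rewrite normr0.
  have -> : Q (S :\: H) = beta ^+ 2 * dotp (comb Y (fun i => beta^-1 * restr x (S :\: H) i)) (comb Y (fun i => beta^-1 * restr x (S :\: H) i)).
    rewrite (eq_dotp (combZ _ _ _) (combZ _ _ _)) dotpZr dotpZl /Q; field; by rewrite gt_eqF.
  apply: ler_wpM2l; first exact: sqr_ge0.
  apply: near => i; rewrite /restr.
    rewrite normrM gtr0_norm ?invr_gt0 // mulrC ler_pdivrMr // mul1r.
    by case: ifP => [/xb //|_]; rewrite normr0 ltW.
  by move=> /negbTE iS; rewrite inE iS andbF mulr0.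
have xS : \sum_(i in S) x i ^+ 2 - \sum_(i in S') x i ^+ 2 = \sum_(i in lo) x i ^+ 2.
  by rewrite (big_setID S') /= (setIidPr S'S) addrAC subrr add0r.
(* On [H] the vector is [e + eta * NR]: the rounding error is handled by the norm bound [f], the
   integer part by spreading. *)
have CE : C H = \sum_(i in lo) x i * dotp (Y i) (comb Y e) + \sum_(i in lo) x i * (eta * dotp (Y i) w).
  rewrite /C dotp_comb_comb sum_restr -big_split /=; apply: eq_bigr => i _.
  rewrite -mulrDr; congr (_ * _); rewrite -dotpZr -dotpDr; apply: eq_dotp => // j.
  rewrite -combZ -combD; apply: eq_comb => m; rewrite /e; ring.
have omf : 0 < om * f by rewrite mulr_gt0.
have C1 : 2 * \sum_(i in lo) x i * dotp (Y i) (comb Y e) <= om * f * (\sum_(i in lo) x i ^+ 2) + f * a%:R * eta ^+ 2 / om.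
  apply: le_trans (amgm_sum _ _ _ omf) _; rewrite lerD2l ler_pdivrMr //.
  have -> : f * a%:R * eta ^+ 2 / om * (om * f) = f * (f * (a%:R * eta ^+ 2)).
    by field; rewrite gt_eqF.
  apply: le_trans (sum_sub_sqr _ _) _; apply: le_trans (F2 _) _; rewrite ler_pM2l //.
  by apply: le_trans (F1 _) _; rewrite ler_pM2l.
(* Indices of [lo] lie outside [Top], and [NN] lets [eta ^+ 2] compensate the length of the integer
   vector. *)
have C2 : 2 * \sum_(i in lo) x i * (eta * dotp (Y i) w) <= om * f * (\sum_(i in lo) x i ^+ 2) + k%:R * s / om.
  apply: le_trans (amgm_sum _ _ _ omf) _; rewrite lerD2l ler_pdivrMr //.
  have -> : k%:R * s / om * (om * f) = k%:R * (s * f) by field; rewrite gt_eqF.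
  apply: le_trans (sum_card_le (c := s * f) _) _.
    move=> i; rewrite !inE => /andP[h iS]; rewrite exprMn.
    apply: le_trans (_ : eta ^+ 2 * (s * dotp w w) <= _).
      apply: ler_wpM2l; first exact: sqr_ge0.
      by rewrite leNgt; apply: contra h => h; rewrite iS h !andbT orbN.
    rewrite mulrCA; apply: ler_wpM2l => //.
    apply: le_trans (_ : eta ^+ 2 * (f * dotp NR NR) <= _).
      by apply: ler_wpM2l; [exact: sqr_ge0|exact: F1].
    by rewrite sqr_dotp mulrCA ler_piMr // ltW.
  apply: ler_wpM2r; first by rewrite mulr_ge0 // ltW.
  rewrite ler_nat; apply: leq_trans Sk; apply: subset_leq_card; exact: subsetDl.
exists S'; split => //.
  rewrite cardsU; apply: leq_trans (leq_subr _ _) _; apply: leq_add => //.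
  apply: ltnW; apply: leq_trans Tl; rewrite ltnS; apply: subset_leq_card; apply/subsetP => i.
  rewrite !inE => /andP[/andP[iH _] ->]; by rewrite supN.
rewrite -/(Q S) -/(Q S') xS.
move: Q1 Q2 Q3 Q4 nearSH CE C1 C2; lra.
Qed.

End Peel.

(** * The deterministic bound *)

Section Condensation.
Context (R : realFieldType).

(** [H r] holds the [r] largest entries in absolute value and [y r] is the next one, counted from
    [0]; past the last entry [y] takes the default value [0] of [nth]. *)
Lemma decreasing_rearrangement (n : nat) (x : 'I_n -> R) :
  exists (H : nat -> {set 'I_n}) (y : nat -> R),
    [/\ forall r, (#|H r| <= r)%N, forall r i, i \notin H r -> `|x i| <= y r,
        {homo y : r t / (r <= t)%N >-> t <= r}, forall r, 0 <= y r &
        forall m, \sum_(r < m) y r ^+ 2 <= \sum_i x i ^+ 2].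
Proof.
pose ge i j := `|x j| <= `|x i|.
have ge_tr : transitive ge by move=> a b c h h'; exact: le_trans h' h.
have ge_tot : total ge by move=> a b; exact: le_total.
pose s := sort ge (enum 'I_n).
have ss : sorted ge s by exact: sort_sorted.
have ms i : i \in s by rewrite mem_sort mem_enum.
have us : uniq s by rewrite sort_uniq enum_uniq.
have sz : size s = n by rewrite size_sort size_enum_ord.
pose xs := [seq `|x i| | i <- s].
have sxs : sorted (fun a b : R => b <= a) xs by rewrite sorted_map.
exists (fun r => [set i in take r s]), (fun r => nth 0 xs r); split.
- move=> r; rewrite cardsE; apply: leq_trans (card_size _) _.
  by rewrite size_take_min geq_minl.
- move=> r i; rewrite inE => it.
  have ix : (index i s < size s)%N by rewrite index_mem.
  have ri : (r <= index i s)%N.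
    by rewrite leqNgt; apply: contra it => h; rewrite in_take ?inE.
  have -> : `|x i| = nth 0 xs (index i s) by rewrite (nth_map i) // nth_index.
  apply: (sorted_leq_nth (leT := fun a b : R => b <= a)) => //.
  + by move=> a b c h h'; exact: le_trans h' h.
  + by rewrite inE size_map (leq_ltn_trans ri).
  + by rewrite inE size_map.
- move=> r t rt; have [tn|tn] := ltnP t (size xs); last first.
    rewrite (nth_default _ tn).
    have [rn|rn] := ltnP r (size xs); last by rewrite nth_default.
    have [i _ ->] := mapP (mem_nth 0 rn); exact: normr_ge0.
  apply: (sorted_leq_nth (leT := fun a b : R => b <= a)) => //.
  + by move=> a b c h h'; exact: le_trans h' h.
  + by rewrite inE (leq_ltn_trans rt).
- move=> r; have [rn|rn] := ltnP r (size xs); last by rewrite nth_default.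
  by have [i _ ->] := mapP (mem_nth 0 rn); exact: normr_ge0.
- move=> m.
  have szx : size xs = n by rewrite size_map.
  have E : \sum_i x i ^+ 2 = \sum_(r < n) (nth 0 xs r) ^+ 2.
    rewrite -(big_mkord xpredT (fun r => nth 0 xs r ^+ 2)) -[in RHS]szx -(big_nth 0 xpredT (fun t => t ^+ 2)).
    rewrite big_map -big_enum /= (perm_big s) /=; last by rewrite perm_sym perm_sort.
    by apply: eq_bigr => i _; rewrite real_normK ?num_real.
  rewrite E -!(big_mkord xpredT (fun r => nth 0 xs r ^+ 2)).
  have [mn|nm] := leqP m n.
    rewrite (big_cat_nat (leq0n m) mn) //= lerDl; apply: sumr_ge0 => i _; exact: sqr_ge0.
  rewrite (big_cat_nat (leq0n n) (ltnW nm)) //= [X in _ + X]big1_seq ?addr0 // => i.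
  rewrite mem_index_iota => /andP[_ /andP[ni _]]; by rewrite nth_default ?szx // expr0n.
Qed.

(** Each of the [2 ^ m] terms with index in [[2 ^ m, 2 ^ m.+1)] is at least the one at
    [2 ^ m.+1]. *)
Lemma cauchy_condensation (y : nat -> R) (m : nat) :
  {homo y : r t / (r <= t)%N >-> t <= r} -> (forall r, 0 <= y r) ->
  \sum_(v < m.+1) 2 ^+ v * y (2 ^ v)%N <= 2 * \sum_(r < 2 ^ m) y r.
Proof.
move=> yd y0; elim: m => [|m IH].
  rewrite expn0 !big_ord1 expr0 mul1r expn0; have := yd 0%N 1%N isT; have := y0 0%N; lra.
rewrite big_ord_recr /= -!(big_mkord xpredT) (big_cat_nat (leq0n (2 ^ m)%N)) //=; last first.
  by rewrite leq_exp2l.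
rewrite mulrDr; apply: lerD; first by move: IH; rewrite -!(big_mkord xpredT).
rewrite exprS -mulrA ler_pM2l //.
apply: le_trans (_ : \sum_(2 ^ m <= i < 2 ^ m.+1) y (2 ^ m.+1)%N <= _).
  by rewrite sumr_const_nat expnS mul2n -addnn addnK -[leRHS]mulr_natl natrX.
apply: ler_sum_nat => i /andP[_ h]; apply: yd; exact: ltnW.
Qed.

Lemma sqr_sum_le (I : finType) (P : pred I) (a : I -> R) :
  (\sum_(i | P i) a i) ^+ 2 <= #|P|%:R * \sum_(i | P i) a i ^+ 2.
Proof.
have [P0|P0] := posnP #|P|.
  rewrite !big_pred0 ?expr0n ?mulr0 //; by move/card0_eq: P0 => h i; exact: h.
have t0 : 0 < #|P|%:R :> R by rewrite ltr0n.
set A := \sum_(i | P i) a i.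
have E : (\sum_(i | P i) A ^+ 2) / #|P|%:R = A ^+ 2.
  by rewrite sumr_const -[X in X / _]mulr_natl mulrAC divff ?gt_eqF // mul1r.
have := amgm_sum P a (fun=> A) t0.
rewrite -mulr_suml -/A E -expr2; lra.
Qed.

Lemma geometric_le (t : R) (m : nat) : 0 <= t < 1 -> \sum_(v < m) t ^+ v <= (1 - t)^-1.
Proof.
move=> /andP[t0 t1]; have h : 0 < 1 - t by rewrite subr_gt0.
rewrite -[leRHS]mul1r ler_pdivlMr // mulrC -opprB mulNr -subrX1 opprB lerBlDr lerDl.
exact: exprn_ge0.
Qed.

End Condensation.

(** The summands come, in this order, from the set where the peeling stops, from the flat vectors
    and from the geometric sum of the spreading thresholds. *)
Definition energy_const (R : realType) (K sig : R) (c u1 : nat) : R :=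
  2 ^+ (u1 + (c + 7)) + 2 ^+ (c + 3) * ((2 + 2 * K * 2 ^+ (c + 7)) * 2 ^+ (c + 7 + c + 1) * 2 ^+ (c + 7))
    + 16 * K * sig ^+ 2 / (1 - sig / 2).

Section Core.
Context (R : realType) (n d : nat) (Y : 'I_n -> 'I_d -> R) (f M K sig : R).
Context (f0 : 0 < f) (M0 : 0 < M) (K0 : 0 <= K) (sig02 : 0 <= sig < 2).
Context (F1 : forall z, dotp (comb Y z) (comb Y z) <= f * dotp z z).
Context (F2 : forall w, \sum_i dotp (Y i) w ^+ 2 <= f * dotp w w).
Context (YM : forall i, dotp (Y i) (Y i) <= M).
Context (c u1 U : nat) (cu1 : (c <= u1)%N).
Context (sp : forall u, (u1 <= u <= U)%N ->
  spread Y (2 ^ (u - c)) (2 ^ u) ((2 ^ (u - c) * 2 ^ (6 + (U - u)))%N%:R) (K * sig ^+ (U - u))).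

(* This [g], the [6] in [sp] and the [16] below make the terms in [f] add up to [f / 2]. *)
Let g := (c + 7)%N.
Let C1 := (2 * M + 2 * K * 2 ^+ (U + g)) * 2 ^+ (g + c + 1) * 2 ^+ g.
(** Energy of a flat vector per coordinate of its support, read off from [flat_energy] with [kap]
    equal to the inverse of [2 ^+ g]; [C1] gathers the terms in [M] and in the threshold. *)
Let Phi := 4 * f / 2 ^+ g + C1.

Lemma energy_small (x : 'I_n -> R) (S : {set 'I_n}) (k : nat) : (#|S| <= k)%N ->
  dotp (comb Y (restr x S)) (comb Y (restr x S)) <= k%:R * M * \sum_(i in S) x i ^+ 2.
Proof.
move=> Sk; rewrite sqr_dotp.
apply: le_trans (_ : \sum_j k%:R * \sum_(i in S) (x i * Y i j) ^+ 2 <= _).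
  apply: ler_sum => j _; rewrite /comb sum_restr.
  apply: le_trans (sqr_sum_le _ _) _; apply: ler_wpM2r; last by rewrite ler_nat.
  by apply: sumr_ge0 => i _; exact: sqr_ge0.
rewrite -mulr_sumr -mulrA; apply: ler_wpM2l; first exact: ler0n.
rewrite exchange_big /= mulr_sumr; apply: ler_sum => i _.
under eq_bigr do rewrite exprMn.
rewrite -mulr_sumr mulrC; apply: ler_wpM2r; first exact: sqr_ge0.
by rewrite -sqr_dotp.
Qed.

Lemma sig_le (m k : nat) : 2 ^+ m * sig ^+ k <= 2 ^+ (m + k).
Proof.
have /andP[s0 s2] := sig02.
by rewrite exprD ler_pM2l ?exprn_gt0 // lerXn2r // ?nnegrE // ltW.
Qed.

Lemma flat_energy_level (u : nat) (S : {set 'I_n}) (z : 'I_n -> R) :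
  (u1 + g <= u <= U)%N -> (#|S| <= 2 ^ u)%N ->
  (forall i, `|z i| <= 1) -> (forall i, i \notin S -> z i = 0) ->
  dotp (comb Y z) (comb Y z) <= (2 ^ u)%N%:R * Phi.
Proof.
move=> /andP[u1u uU] Su z1 zS.
have gu : (g <= u)%N by apply: leq_trans u1u; exact: leq_addl.
(* Spreading is used [g] levels below [u], which makes [a + l] a fraction of order [2 ^- g] of
   [2 ^ u]. *)
have ug : (u1 <= u - g <= U)%N.
  by rewrite leq_subRL // addnC u1u (leq_trans (leq_subr _ _)).
have cug : (c <= u - g)%N by case/andP: ug => /(leq_trans cu1).
(* Then [2 * q * 2 ^ u] is exactly the support size allowed at level [u - g]. *)
pose q : R := (2 ^+ (g + c + 1))^-1.
have two0 k : 0 < 2 ^+ k :> R by rewrite exprn_gt0.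
have q0 : 0 < q by rewrite invr_gt0.
have q01 : 0 < q <= 1.
  rewrite q0 /= invf_le1 //; rewrite exprn_ege1 //; lra.
have kap0 : 0 < (2 ^+ g)^-1 :> R by rewrite invr_gt0.
have s0 : 0 <= K * sig ^+ (U - (u - g)).
  by rewrite mulr_ge0 // exprn_ge0 //; case/andP: sig02.
have Eu : 2 ^+ u = 2 ^+ (u - g - c) * 2 ^+ (g + c) :> R.
  by rewrite -exprD; congr (_ ^+ _); move: gu cug; clear; lia.
have qa : 2 * q * (2 ^ u)%N%:R <= (2 ^ (u - g - c))%N%:R.
  rewrite !natrX Eu /q addn1 exprS le_eqVlt; apply/orP; left; apply/eqP.
  by field; rewrite gt_eqF.
have al : (2 ^ (u - g - c) + 2 ^ (u - g))%N%:R <= 2 * (2 ^ u)%N%:R / 2 ^+ g :> R.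
  rewrite ler_pdivlMr // natrD mulrDl !natrX -!exprD subnK // mulr_natl mulr2n lerD2r.
  rewrite ler_eXn2l; last lra.
  move: gu; clear; lia.
have ks : (2 ^ u)%N%:R * (K * sig ^+ (U - (u - g))) <= K * 2 ^+ (U + g).
  rewrite mulrCA natrX; apply: ler_wpM2l => //; apply: le_trans (sig_le _ _) _.
  have -> // : (u + (U - (u - g)) = U + g)%N by move: gu uU; clear; lia.
have b1 : (2 ^ (u - g - c))%N%:R <= (2 ^ (u - g - c) * 2 ^ (6 + (U - (u - g))))%N%:R :> R.
  by rewrite ler_nat leq_pmulr // expn_gt0.
have hn := flat_energy f0 M0 F1 F2 YM Su z1 zS q01 kap0 s0 qa b1 (sp ug).
apply: le_trans hn _.
have k0 : 0 <= (2 ^ u)%N%:R :> R by rewrite ler0n.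
rewrite /Phi /C1.
move: al ks; move: ((2 ^ (u - g - c) + 2 ^ (u - g))%N%:R) (K * sig ^+ _) ((2 ^ u)%N%:R) k0 => A s k k0 al ks.
have := ler_wpM2r (ltW f0) al; have := ler_wpM2l (mulr_ge0 k0 (ltW (mulr_gt0 (two0 (g + c + 1)%N) (two0 g)))) ks.
have -> : 2 * k * M / ((2 ^+ g)^-1 * q) = 2 * k * M * (2 ^+ (g + c + 1) * 2 ^+ g).
  by rewrite /q; field; rewrite !gt_eqF.
have -> : 2 * k ^+ 2 * s / ((2 ^+ g)^-1 * q) = 2 * k * (2 ^+ (g + c + 1) * 2 ^+ g * (k * s)).
  by rewrite /q; field; rewrite !gt_eqF.
have h3 : 2 / 2 ^+ g * f * k = 2 * k / 2 ^+ g * f by field; rewrite gt_eqF.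
have h4 : k * (4 * f / 2 ^+ g) = 2 * (2 * k / 2 ^+ g * f) by field; rewrite gt_eqF.
rewrite h3 mulrDr h4; lra.
Qed.

Let u0 := (u1 + g)%N.

(** Peeling goes down from level [u0 + j] to [u0], where [energy_small] takes over. The multiples of
    the lost mass telescope into [f / 8] times the mass of [S]. *)
Lemma peel_induction (x : 'I_n -> R) (H : nat -> {set 'I_n}) (y : nat -> R) :
  \sum_i x i ^+ 2 <= 1 -> (forall r, (#|H r| <= r)%N) ->
  (forall r i, i \notin H r -> `|x i| <= y r) ->
  forall (j : nat) (S : {set 'I_n}), (u0 + j <= U)%N -> (#|S| <= 2 ^ (u0 + j))%N ->
  dotp (comb Y (restr x S)) (comb Y (restr x S)) <=
    2 ^+ u0 * M + f / 8 * (\sum_(i in S) x i ^+ 2) +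
    \sum_(i < j) (2 ^+ (u0 + i.+1) * y (2 ^ (u0 + i.+1 - c - 2))%N ^+ 2 * Phi
      + f / 16 * (2^-1) ^+ (U - (u0 + i.+1))
      + 16 * K * sig ^+ 2 * (2 ^+ (u0 + i.+1) * sig ^+ (U - (u0 + i.+1)))).
Proof.
move=> x1 cH yH; elim=> [|j IH] S jU Sj.
  rewrite big_ord0 addr0; apply: le_trans (energy_small x Sj) _.
  have h0 : 0 <= \sum_(i in S) x i ^+ 2 by apply: sumr_ge0 => i _; exact: sqr_ge0.
  have h1 : \sum_(i in S) x i ^+ 2 <= 1 by apply: le_trans (sum_sub_sqr _ _) x1.
  rewrite addn0 natrX.
  have := ler_wpM2l (mulr_ge0 (exprn_ge0 u0 (ler0n R 2)) (ltW M0)) h1.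
  have := mulr_ge0 (ltW f0) h0; lra.
set u := (u0 + j.+1)%N in jU Sj *.
have uU : (u1 + g <= u <= U)%N by rewrite jU leq_addr.
have [u2 cu] : (u1 <= u - 2 <= U)%N /\ (c + 2 <= u)%N.
  by move: jU cu1; rewrite /u /u0 /g; clear; lia.
(* Spreading two levels down gives [a + l <= 2 ^ (u - 1)], the size required by the induction. *)
pose a := (2 ^ (u - 2 - c))%N.
pose b : R := (2 ^ (u - 2 - c) * 2 ^ (6 + (U - (u - 2))))%N%:R.
have two0 k : 0 < 2 ^+ k :> R by rewrite exprn_gt0.
have b0 : 0 < b by rewrite ltr0n muln_gt0 !expn_gt0.
(* The finest grid compatible with the length [b] allowed by spreading. *)
have eta0 : 0 < Num.sqrt b^-1 by rewrite sqrtr_gt0 invr_gt0.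
have eta2 : Num.sqrt b^-1 ^+ 2 = b^-1 by rewrite sqr_sqrtr // invr_ge0 ltW.
have Ha : (#|S :&: H a| <= a)%N by apply: leq_trans (cH a); rewrite subset_leq_card // subsetIr.
have xb i : i \in S :\: (S :&: H a) -> `|x i| <= y a.
  by rewrite !inE => /andP[]; rewrite negb_and => /orP[/negbTE -> //|/yH].
have be : 1 <= b * Num.sqrt b^-1 ^+ 2 by rewrite eta2 divff // gt_eqF.
have om0 : 0 < 16^-1 :> R by rewrite invr_gt0.
have s0 : 0 <= K * sig ^+ (U - (u - 2)) by rewrite mulr_ge0 // exprn_ge0 //; case/andP: sig02.
have [S' [S'S cS']] := peel_step f0 F1 F2 x1 Sj (subsetIl S (H a)) Ha xb
  (fun z => flat_energy_level uU Sj) (sp u2) s0 eta0 be om0.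
have S'j : (#|S'| <= 2 ^ (u0 + j))%N.
  apply: leq_trans cS' _; have -> : (u0 + j = u - 2 + 1)%N by move: cu; rewrite /u; clear; lia.
  rewrite expnD muln2 -addnn leq_add2r leq_exp2l //; clear; lia.
have := IH S' _ S'j; rewrite (leq_trans _ jU) ?leq_add2l // => /(_ isT).
rewrite big_ord_recr /= -/u eta2 natrX.
have -> : f * a%:R / b / 16^-1 = f / 16 * 2^-1 ^+ (U - u).
  have -> : b = a%:R * (256 * 2 ^+ (U - u)).
    rewrite /a /b natrM !natrX.
    have -> : (6 + (U - (u - 2)) = 8 + (U - u))%N by move: cu jU; rewrite -/u; clear; lia.
    by rewrite exprD -[2 ^+ 8]natrX.
  by rewrite exprVn; field; rewrite !gt_eqF // ltr0n expn_gt0.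
have -> : 2 ^+ u * (K * sig ^+ (U - (u - 2))) / 16^-1 = 16 * K * sig ^+ 2 * (2 ^+ u * sig ^+ (U - u)).
  have -> : (U - (u - 2) = 2 + (U - u))%N by move: cu jU; rewrite -/u; clear; lia.
  by rewrite exprD; field.
rewrite (subnAC u c 2) -/a; lra.
Qed.

(** The multiples of [f] are [f / 8] from the telescoped mass, [f / 8] from the rounding errors and
    [f / 4] from the flat vectors. *)
Lemma energy_bound (x : 'I_n -> R) : \sum_i x i ^+ 2 <= 1 -> (u0 <= U)%N -> (n <= 2 ^ U)%N ->
  dotp (comb Y x) (comb Y x) <= f / 2 + 2 ^+ u0 * M + 2 ^+ (c + 3) * C1
    + 16 * K * sig ^+ 2 * 2 ^+ U / (1 - sig / 2).
Proof.
move=> x1 uU nU.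
have [H [y [cH yH yd y0 ys]]] := decreasing_rearrangement x.
have cT : (#|[set: 'I_n]| <= 2 ^ (u0 + (U - u0)))%N by rewrite subnKC // cardsT card_ord.
have uj : (u0 + (U - u0) <= U)%N by rewrite subnKC.
have := peel_induction x1 cH yH uj cT.
rewrite (eq_dotp (u' := comb Y x) (v' := comb Y x)); first last.
- by apply: eq_comb => i; rewrite /restr inE.
- by apply: eq_comb => i; rewrite /restr inE.
move=> h; apply: le_trans h _.
have two0 k : 0 < 2 ^+ k :> R by rewrite exprn_gt0.
have xT : \sum_(i in [set: 'I_n]) x i ^+ 2 <= 1 by apply: le_trans (sum_sub_sqr _ _) x1.
set j := (U - u0)%N.
pose V1 := \sum_(i < j) 2 ^+ (u0 + i.+1) * y (2 ^ (u0 + i.+1 - c - 2))%N ^+ 2.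
pose V2 : R := \sum_(i < j) 2^-1 ^+ (U - (u0 + i.+1)).
pose V3 := \sum_(i < j) 2 ^+ (u0 + i.+1) * sig ^+ (U - (u0 + i.+1)).
set V4 := \sum_(i in _) _ in xT *.
rewrite [X in _ + X](_ : _ = V1 * Phi + f / 16 * V2 + 16 * K * sig ^+ 2 * V3); last first.
  by rewrite /V1 mulr_suml /V2 /V3 !mulr_sumr -!big_split.
have Phi0 : 0 <= Phi.
  apply: addr_ge0; first by rewrite divr_ge0 ?mulr_ge0 // ltW.
  rewrite /C1 !mulr_ge0 ?(ltW (two0 _)) // addr_ge0 // ?mulr_ge0 ?(ltW (two0 _)) //; exact: ltW.
(* The shift by [c + 2] in the index of [y] costs [2 ^+ (c + 2)], and condensation costs the last
   factor [2]. *)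
have sA : V1 <= 2 ^+ (c + 3).
  rewrite /V1.
  pose w0 := (u0 - c - 1)%N.
  have E (i : 'I_j) : 2 ^+ (u0 + i.+1) * y (2 ^ (u0 + i.+1 - c - 2))%N ^+ 2 =
      2 ^+ (c + 2) * (2 ^+ (w0 + i) * y (2 ^ (w0 + i))%N ^+ 2).
    have -> : (u0 + i.+1 - c - 2 = w0 + i)%N by move: cu1; rewrite /w0 /u0 /g; clear; lia.
    have -> : (u0 + i.+1 = c + 2 + (w0 + i))%N by move: cu1; rewrite /w0 /u0 /g; clear; lia.
    by rewrite exprD mulrA.
  rewrite (eq_bigr _ (fun i _ => E i)) -mulr_sumr (addnS c 2) exprSr ler_pM2l //.
  have ydd : {homo (fun r => y r ^+ 2) : r t / (r <= t)%N >-> t <= r}.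
    by move=> r t rt; rewrite lerXn2r ?nnegrE // yd.
  have := cauchy_condensation (w0 + j) ydd (fun r => sqr_ge0 (y r)).
  move=> h; apply: le_trans (_ : 2 * \sum_(r < 2 ^ (w0 + j)) y r ^+ 2 <= _); last first.
    by have := ys (2 ^ (w0 + j))%N; move: x1; lra.
  have p0 k : 0 <= 2 ^+ k * y (2 ^ k)%N ^+ 2 by rewrite mulr_ge0 ?sqr_ge0 // ltW.
  apply: le_trans h; rewrite big_ord_recr big_split_ord /= -addrA addrCA lerDl.
  by rewrite addr_ge0 // sumr_ge0.
have rev (F : nat -> R) : \sum_(i < j) F (U - (u0 + i.+1))%N = \sum_(i < j) F i.
  rewrite [RHS](reindex_inj rev_ord_inj); apply: eq_bigr => i _; congr F => /=.
  by rewrite subnDA.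
have sB : V2 <= 2.
  rewrite /V2.
  have h2 : 0 <= (2^-1 : R) < 1 by apply/andP; split; lra.
  rewrite (rev (fun k => 2^-1 ^+ k)); apply: le_trans (geometric_le _ h2) _.
  by rewrite (_ : 1 - 2^-1 = 2^-1) ?invrK //; field.
(* Read from the top level [U] downwards, the sum is geometric of ratio [sig / 2 < 1]. *)
have sC : V3 <= 2 ^+ U / (1 - sig / 2).
  rewrite /V3.
  have E (i : 'I_j) : 2 ^+ (u0 + i.+1) * sig ^+ (U - (u0 + i.+1)) = 2 ^+ U * (sig / 2) ^+ (U - (u0 + i.+1)).
    have iU : (u0 + i.+1 <= U)%N by rewrite -leq_subRL // /j ltn_ord.
    have -> : 2 ^+ U = 2 ^+ (u0 + i.+1) * 2 ^+ (U - (u0 + i.+1)) :> R by rewrite -exprD subnKC.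
    rewrite exprMn exprVn; field.
    by rewrite gt_eqF.
  rewrite (eq_bigr _ (fun i _ => E i)) -mulr_sumr ler_pM2l // (rev (fun k => (sig / 2) ^+ k)).
  by apply: geometric_le; case/andP: sig02 => *; apply/andP; split; lra.
have KS : 0 <= 16 * K * sig ^+ 2 by rewrite mulr_ge0 ?sqr_ge0 // mulr_ge0.
have := ler_wpM2l KS sC; have := ler_wpM2r Phi0 sA.
have PE : 2 ^+ (c + 3) * Phi = f / 4 + 2 ^+ (c + 3) * C1.
  rewrite /Phi mulrDr; congr (_ + _).
  by rewrite /g (_ : (c + 7 = c + 3 + 4)%N); [rewrite (exprD _ (c + 3)); field; rewrite gt_eqF|rewrite -addnA].
rewrite PE => hA hC; have hB := ler_wpM2l (ltW f0) sB; have hD := ler_wpM2l (ltW f0) xT.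
move: hA hB hC hD.
clearbody V1 V2 V3 V4; lra.
Qed.

Lemma energy_le_const (x : 'I_n -> R) : \sum_i x i ^+ 2 <= 1 -> (u1 + (c + 7) <= U)%N -> (n <= 2 ^ U)%N ->
  dotp (comb Y x) (comb Y x) <= f / 2 + energy_const K sig c u1 * (M + 2 ^+ U).
Proof.
move=> x1 uU nU; apply: le_trans (energy_bound x1 uU nU) _.
have two0 k : 0 <= 2 ^+ k :> R by rewrite exprn_ge0.
have sig2 : 0 <= (1 - sig / 2)^-1.
  by rewrite invr_ge0; case/andP: sig02 => *; lra.
have KS : 0 <= 16 * K * sig ^+ 2 by rewrite mulr_ge0 ?sqr_ge0 // mulr_ge0.
rewrite /energy_const /C1 /g /u0 exprD -/g.
set G := 2 ^+ (c + 7); set D := 2 ^+ (c + 7 + c + 1); set E := 2 ^+ (c + 3); set V := 2 ^+ U.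
have [G0 D0 E0 V0] : [/\ 0 <= G, 0 <= D, 0 <= E & 0 <= V] by split; exact: two0.
have -> : 2 ^+ (U + g) = V * G by rewrite exprD.
move: (16 * K * sig ^+ 2) KS ((1 - sig / 2)^-1) sig2 (2 ^+ u1) (two0 u1) => W W0 i i0 Z Z0.
rewrite -subr_ge0.
have -> : f / 2 + (Z * G + E * ((2 + 2 * K * G) * D * G) + W * i) * (M + V) -
    (f / 2 + Z * G * M + E * ((2 * M + 2 * K * (V * G)) * D * G) + W * V * i) =
    Z * G * V + E * D * G * (2 * V + 2 * K * G * M) + W * i * M by ring.
have M0' := ltW M0.
by rewrite !addr_ge0 // ?mulr_ge0 // addr_ge0 // !mulr_ge0.
Qed.

End Core.

From mathcomp Require Import all_classical all_analysis.
From mathcomp Require Import measurable_realfun.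
Local Open Scope classical_set_scope.

(** * Independence and Fubini *)

(** The joint law of [X] and [Z] agrees with the product of their laws on rectangles, hence
    everywhere; Tonelli does the rest. *)
Lemma integral_independent_pair (R : realType) d d1 d2 (T : measurableType d)
    (U : measurableType d1) (V : measurableType d2) (P : probability T R)
    (X : T -> U) (Z : T -> V) (phi : (U * V)%type -> \bar R) :
  measurable_fun setT X -> measurable_fun setT Z ->
  (forall A B, measurable A -> measurable B ->
    P (X @^-1` A `&` Z @^-1` B) = (P (X @^-1` A) * P (Z @^-1` B))%E) ->
  measurable_fun setT phi -> (forall x, (0 <= phi x)%E) ->
  (\int[P]_w phi (X w, Z w) = \int[P]_w \int[P]_v phi (X v, Z w))%E.
Proof.
move=> mX mZ XZ mphi phi0.
pose X' : {mfun T >-> U} := mfun_Sub (mem_set mX).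
pose Z' : {mfun T >-> V} := mfun_Sub (mem_set mZ).
have mXZ : measurable_fun setT (fun w => (X w, Z w)) by exact: measurable_fun_pair.
pose XZ' : {mfun T >-> (U * V)%type} := mfun_Sub (mem_set mXZ).
have E : forall C, measurable C ->
    ((distribution P X' : probability _ R) \x (distribution P Z' : probability _ R))%E C = distribution P XZ' C.
  by apply: product_measure_unique => A B mA mB; exact: XZ.
transitivity (\int[distribution P XZ']_y phi y)%E.
  by rewrite ge0_integral_distribution.
transitivity (\int[((distribution P X' : probability _ R) \x (distribution P Z' : probability _ R))%E]_y phi y)%E.
  apply: eq_measure_integral => C mC _; exact/esym/E.
rewrite fubini_tonelli2 //.
rewrite ge0_integral_distribution //; last 2 first.
- exact: measurable_fun_fubini_tonelli_G.
- move=> y; exact: integral_ge0.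
apply: eq_integral => w _ /=.
rewrite /fubini_G ge0_integral_distribution //.
by apply: (measurableT_comp mphi); exact: measurable_fun_pair.
Qed.

Lemma measurable_partial_integral (R : realType) d d1 d2 (T : measurableType d)
    (U : measurableType d1) (V : measurableType d2) (P : probability T R)
    (X : T -> U) (phi : (U * V)%type -> \bar R) :
  measurable_fun setT X -> measurable_fun setT phi -> (forall x, (0 <= phi x)%E) ->
  measurable_fun setT (fun z => \int[P]_v phi (X v, z))%E.
Proof.
move=> mX mphi phi0.
pose X' : {mfun T >-> U} := mfun_Sub (mem_set mX).
have := @measurable_fun_fubini_tonelli_G _ _ _ _ _ (distribution P X' : probability _ R) phi mphi phi0.
apply: eq_measurable_fun => z _; rewrite /fubini_G ge0_integral_distribution //.
by apply: (measurableT_comp mphi); exact: measurable_fun_pair.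
Qed.

Section Indep.
Context (R : realType) (I : finType) d d' (T : measurableType d) (U : measurableType d')
  (P : probability T R) (X : I -> T -> U).
Context (mX : forall i, measurable_fun setT (X i)) (iX : independent_family P X).

(* The pi-system generating the sigma-algebra of the [X j] with [j != i]. *)
Definition others (i : I) : set (set T) :=
  [set E | exists B : I -> set U, [/\ forall j, measurable (B j), B i = setT &
     E = \bigcap_j (X j @^-1` B j)]].

Let mpre i A : measurable A -> measurable (X i @^-1` A).
Proof. by move=> mA; rewrite -[X in measurable X]setTI; exact: mX. Qed.

Let mcap (B : I -> set U) : (forall j, measurable (B j)) -> measurable (\bigcap_j (X j @^-1` B j)).
Proof.
move=> mB; apply: fin_bigcap_measurable => // j _; exact: mpre.
Qed.

Lemma others_measurable i : others i `<=` measurable.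
Proof. by move=> E [B [mB _ ->]]; exact: mcap. Qed.

Lemma indep_rect (B : I -> set U) : (forall j, measurable (B j)) ->
  P (\bigcap_j (X j @^-1` B j)) = ((\prod_j fine (P (X j @^-1` B j)))%:E)%E.
Proof.
by move=> mB; rewrite -(iX mB) fineK // fin_num_measure //; exact: mcap.
Qed.

(** Both sides are finite measures in [E] that agree on the pi-system [others i], hence on the
    sigma-algebra it generates. *)
Lemma indep_others i A E : measurable A -> <<s others i >> E ->
  P (X i @^-1` A `&` E) = (P (X i @^-1` A) * P E)%E.
Proof.
move=> mA.
have fA : P (X i @^-1` A) \is a fin_num by rewrite fin_num_measure //; exact: mpre.
have pA : 0 <= fine (P (X i @^-1` A)) by rewrite fine_ge0.
pose m1 := mrestr P (mpre i mA).
pose m2 := mscale (NngNum pA) P.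
suff h : forall E, <<s others i >> E -> m1 E = m2 E.
  by move=> /h; rewrite /m1 /m2 /mrestr /mscale /= fineK // setIC.
apply: (@g_sigma_algebra_measure_unique _ _ _ (others i) _ (fun=> setT)).
- exact: others_measurable.
- move=> _; exists (fun=> setT); split => //.
  by rewrite predeqE.
- by rewrite bigcup_const //; exists 0%N.
- move=> _ _ [B [mB Bi ->]] [B' [mB' B'i ->]]; exists (fun j => B j `&` B' j); split.
  + by move=> j; exact: measurableI.
  + by rewrite Bi B'i setTI.
  + by rewrite -bigcapI.
- move=> _ [B [mB Bi ->]].
  (* Since [B i] is [setT], the set [A] can take its place and the product formula applies to the
     full family. *)
  pose B' j := if j == i then A else B j.
  have mB' j : measurable (B' j) by rewrite /B'; case: ifP.
  change (P (\bigcap_j (X j @^-1` B j) `&` X i @^-1` A) =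
    ((fine (P (X i @^-1` A)))%:E * P (\bigcap_j (X j @^-1` B j)))%E).
  have -> : \bigcap_j (X j @^-1` B j) `&` X i @^-1` A = \bigcap_j (X j @^-1` B' j).
    apply/seteqP; split => w.
      by move=> [hB hA] j _; rewrite /B'; case: eqP => [->|_] //; exact: hB.
    move=> hB; split => [j _|].
      have := hB j Logic.I; rewrite /B'; case: eqP => [->|_] //.
      by rewrite Bi.
    by have := hB i Logic.I; rewrite /B' eqxx.
  rewrite !indep_rect // -EFinM; congr EFin.
  rewrite (bigD1 i) //= [in RHS](bigD1 i) //= /B' eqxx Bi preimage_setT probability_setT /= mul1r.
  by congr (_ * _); apply: eq_bigr => j /negbTE ->.
- move=> k; apply: le_lt_trans (_ : (P setT < +oo)%E); last by rewrite probability_setT ltry.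
  change (P (setT `&` X i @^-1` A) <= P setT)%E; rewrite setTI.
  by apply: le_measure; rewrite ?inE //; exact: mpre.
Qed.

(** The space [T] with a coarser sigma-algebra: the identity into this type stands for the family of
    all [X j] with [j != i], and is independent of [X i]. *)
Definition others_type (i : I) := g_sigma_algebraType (others i).

Lemma measurable_others i j : j != i -> measurable_fun setT (X j : others_type i -> U).
Proof.
move=> ji _ A mA; rewrite setTI; apply: sub_sigma_algebra.
exists (fun k => if k == j then A else setT); split.
- by move=> k; case: ifP.
- by rewrite eq_sym (negbTE ji).
- apply/seteqP; split => w; last by move=> /(_ j Logic.I); rewrite /= eqxx.
  by move=> h k _ /=; case: eqP => [->|].
Qed.

Lemma measurable_id_others i : measurable_fun setT (fun w : T => w : others_type i).
Proof.
move=> _ E mE; rewrite setTI preimage_id.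
have : <<s others i >> E by [].
apply: smallest_sub; [exact: sigma_algebra_measurable|exact: others_measurable].
Qed.

Lemma integral_others i (phi : (U * others_type i)%type -> \bar R) :
  measurable_fun setT phi -> (forall x, (0 <= phi x)%E) ->
  (\int[P]_w phi (X i w, w) = \int[P]_w \int[P]_v phi (X i v, w))%E.
Proof.
move=> mphi phi0.
apply: (@integral_independent_pair _ _ _ _ _ _ (others_type i) P (X i) (fun w => w)) => //.
- exact: measurable_id_others.
- by move=> A E mA mE; rewrite preimage_id; exact: indep_others.
Qed.

End Indep.

(** * Exponential moments of the number of large inner products *)

Section Weights.
Context (R : realType) (n : nat) (p lam : R).

Definition vecs (y : 'I_n -> n.-tuple R) : 'I_n -> 'I_n -> R := fun i j => tnth (y i) j.

(* This is [0] when [comb Y N] vanishes, since [0 `^ (- 2^-1) = 0]. *)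
Definition direction (Y : 'I_n -> 'I_n -> R) (N : 'I_n -> R) : 'I_n -> R :=
  fun j => dotp (comb Y N) (comb Y N) `^ (- 2^-1) * comb Y N j.

Definition weight (u v : 'I_n -> R) : R := 1 + lam * `|dotp u v| `^ p.

Definition weights (s : seq 'I_n) (Y : 'I_n -> 'I_n -> R) (N : 'I_n -> R) : R :=
  \prod_(i <- s) weight (Y i) (direction Y N).

Lemma weight_ge1 (u v : 'I_n -> R) : 0 <= lam -> 1 <= weight u v.
Proof. by move=> l0; rewrite lerDl mulr_ge0 // powR_ge0. Qed.

Lemma weights_ge0 s Y N : 0 <= lam -> 0 <= weights s Y N.
Proof.
move=> l0; apply: prodr_ge0 => i _; apply: le_trans (weight_ge1 _ _ l0); exact: ler01.
Qed.

Lemma measurable_tuple_entry d (V : measurableType d) (y : V -> n.-tuple R) (j : 'I_n) :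
  measurable_fun setT y -> measurable_fun setT (fun w => tnth (y w) j).
Proof. by move=> my; exact: (measurableT_comp (measurable_tnth j)). Qed.

Lemma measurable_comb d (V : measurableType d) (y : 'I_n -> V -> n.-tuple R) (N : 'I_n -> R) (j : 'I_n) :
  (forall i, N i != 0 -> measurable_fun setT (y i)) ->
  measurable_fun setT (fun w => comb (vecs (y ^~ w)) N j).
Proof.
move=> my; apply: measurable_sum => i; have [->|Ni] := eqVneq (N i) 0.
  by under eq_fun do rewrite mul0r; exact: measurable_cst.
by apply: measurable_funM; [exact: measurable_cst|exact/measurable_tuple_entry/my].
Qed.

Lemma measurable_dotp d (V : measurableType d) m (u v : V -> 'I_m -> R) :
  (forall j, measurable_fun setT (u ^~ j)) -> (forall j, measurable_fun setT (v ^~ j)) ->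
  measurable_fun setT (fun w => dotp (u w) (v w)).
Proof. by move=> mu mv; apply: measurable_sum => j; exact: measurable_funM. Qed.

Lemma measurable_direction d (V : measurableType d) (y : 'I_n -> V -> n.-tuple R) (N : 'I_n -> R) (j : 'I_n) :
  (forall i, N i != 0 -> measurable_fun setT (y i)) ->
  measurable_fun setT (fun w => direction (vecs (y ^~ w)) N j).
Proof.
move=> my; apply: measurable_funM; last exact: measurable_comb.
apply: (measurableT_comp (measurable_powR _)).
by apply: measurable_dotp => k; exact: measurable_comb.
Qed.

Lemma measurable_weight d (V : measurableType d) (u v : V -> 'I_n -> R) :
  (forall j, measurable_fun setT (u ^~ j)) -> (forall j, measurable_fun setT (v ^~ j)) ->
  measurable_fun setT (fun w => weight (u w) (v w)).
Proof.
move=> mu mv; apply: measurable_funD; first exact: measurable_cst.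
apply: measurable_funM; first exact: measurable_cst.
apply: (measurableT_comp (measurable_powR _)).
by apply: (measurableT_comp (@normr_measurable _ _)); exact: measurable_dotp.
Qed.

Lemma measurable_weights d (V : measurableType d) (y : 'I_n -> V -> n.-tuple R) (N : 'I_n -> R) (s : seq 'I_n) :
  (forall i, N i != 0 -> measurable_fun setT (y i)) ->
  (forall i, i \in s -> measurable_fun setT (y i)) ->
  measurable_fun setT (fun w => weights s (vecs (y ^~ w)) N).
Proof.
move=> my ms; apply: measurable_prod => i /ms mi; apply: measurable_weight => j.
  exact: measurable_tuple_entry.
exact: measurable_direction.
Qed.

Lemma direction_norm (Y : 'I_n -> 'I_n -> R) N :
  dotp (direction Y N) (direction Y N) = (dotp (comb Y N) (comb Y N) != 0)%:R.
Proof.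
rewrite dotpZl dotpZr; set a := dotp _ _.
have a0 : 0 <= a by exact: dotp_ge0.
have [->|an] := eqVneq a 0; first by rewrite !mulr0.
rewrite powRN powR12_sqrt //=; set t := Num.sqrt a.
have tt : t * t = a by rewrite -expr2 sqr_sqrtr.
have t0 : t != 0 by rewrite sqrtr_eq0 -ltNge lt_def an.
by rewrite -tt; field.
Qed.

End Weights.

Section Moment.
Context (R : realType) (n : nat) (p B lam : R) (p0 : 0 < p) (B0 : 0 <= B) (lam0 : 0 <= lam).
Context (d : measure_display) (T : measurableType d) (P : probability T R)
  (Y : 'I_n -> T -> n.-tuple R).
Context (mY : forall i, measurable_fun setT (Y i)) (iY : independent_family P Y).
Context (momY : forall i (a : 'I_n -> R), dotp a a = 1 ->
  (\int[P]_w (`|dotp (vecs (Y ^~ w) i) a| `^ p)%:E <= B%:E)%E).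

Lemma expect_weight i (v : 'I_n -> R) : dotp v v = 1 \/ dotp v v = 0 ->
  (\int[P]_w (weight p lam (vecs (Y ^~ w) i) v)%:E <= (1 + lam * B)%:E)%E.
Proof.
move=> hv.
have mh : measurable_fun setT (fun w => `|dotp (vecs (Y ^~ w) i) v| `^ p).
  apply: (measurableT_comp (measurable_powR _)).
  apply: (measurableT_comp (@normr_measurable _ _)); apply: measurable_dotp => j.
    exact: measurable_tuple_entry.
  exact: measurable_cst.
under eq_integral do rewrite /weight EFinD EFinM.
rewrite ge0_integralD //; last 2 first.
- by move=> w _; rewrite -EFinM lee_fin mulr_ge0 // powR_ge0.
- by under eq_fun do rewrite -EFinM; apply/measurable_EFinP; exact: measurable_funM.
rewrite [X in (X + _)%E](_ : _ = 1%:E); last first.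
  by rewrite (integral_cst P measurableT 1%:E) mul1e; exact: probability_setT.
rewrite EFinD; apply: leeD2l => //.
rewrite ge0_integralZl_EFin //; last exact/measurable_EFinP.
rewrite EFinM; apply: lee_wpmul2l; first by rewrite lee_fin.
(* The remaining case is that of a vanishing combination, whose [direction] is [0]; there the power
   is [0] because [p] is positive. *)
case: hv => [/momY //|hv].
have v0 j : v j = 0.
  apply/eqP; rewrite -sqrf_eq0; move: hv; rewrite sqr_dotp => /eqP.
  by rewrite psumr_eq0 => [/allP/(_ j (mem_index_enum _))//|k _]; exact: sqr_ge0.
under eq_integral => w _.
  rewrite /dotp big1 => [|j _]; last by rewrite v0 mulr0.
  rewrite normr0 powR0 ?gt_eqF //.
  over.
by rewrite integral0 lee_fin.
Qed.

(** Columns of [s] lie outside the support of [N]. Once the other columns are frozen, the direction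
    and the remaining weights are constant, and integrating over column [i] costs one factor
    [1 + lam * B]. *)
Lemma expect_weights (N : 'I_n -> R) (s : seq 'I_n) : uniq s -> (forall i, i \in s -> N i = 0) ->
  (\int[P]_w (weights p lam s (vecs (Y ^~ w)) N)%:E <= ((1 + lam * B) ^+ size s)%:E)%E.
Proof.
elim: s => [|i s IH] /=.
  move=> _ _; under eq_integral do rewrite /weights big_nil.
  by rewrite (integral_cst P measurableT 1%:E) mul1e expr0 [leLHS]probability_setT.
move=> /andP[is_ us] Ns.
have Ni : N i = 0 by rewrite Ns ?mem_head.
have Ns' k : k \in s -> N k = 0 by move=> ks; rewrite Ns // inE ks orbT.
have ni k : N k != 0 -> k != i by apply: contraNneq => ->; rewrite Ni.
have si k : k \in s -> k != i by move=> ks; apply: contraNneq is_ => <-.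
(* [x.1] is the value of column [i], while [x.2] is a sample point through which only the other
   columns are read. *)
pose phi (x : n.-tuple R * others_type Y i) : \bar R :=
  (weight p lam (fun j => tnth x.1 j) (direction (vecs (Y ^~ x.2)) N)
    * weights p lam s (vecs (Y ^~ x.2)) N)%:E.
have comp_snd (g : others_type Y i -> R) : measurable_fun setT g ->
    measurable_fun [set: (n.-tuple R * others_type Y i)%type] (fun x => g x.2).
  by move=> mg; exact: (measurableT_comp mg measurable_snd).
have mYo k : k != i -> measurable_fun [set: others_type Y i] (Y k).
  by move=> ki; exact: measurable_others.
have mdir j : measurable_fun setT (fun w : others_type Y i => direction (vecs (Y ^~ w)) N j).
  by apply: measurable_direction => k /ni; exact: mYo.
have mws : measurable_fun setT (fun w : others_type Y i => weights p lam s (vecs (Y ^~ w)) N).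
  by apply: measurable_weights => k; [move=> /ni|move=> /si]; exact: mYo.
have mphi : measurable_fun setT phi.
  apply/measurable_EFinP; apply: measurable_funM; last exact: comp_snd mws.
  apply: measurable_weight => j; last exact: comp_snd (mdir j).
  exact: (measurableT_comp (measurable_tnth j) measurable_fst).
have phi0 x : (0 <= phi x)%E.
  rewrite lee_fin mulr_ge0 ?weights_ge0 //; apply: le_trans (weight_ge1 _ _ _ lam0) => //.
have mW : measurable_fun setT (fun w => weights p lam s (vecs (Y ^~ w)) N).
  by apply: measurable_weights.
have lB : 0 <= 1 + lam * B by rewrite addr_ge0 // mulr_ge0.
have -> : (\int[P]_w (weights p lam (i :: s) (vecs (Y ^~ w)) N)%:E = \int[P]_w phi (Y i w, w))%E.
  by apply: eq_integral => w _; rewrite /weights big_cons.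
rewrite (integral_others mY iY mphi phi0).
apply: (@le_trans _ _ (\int[P]_w ((1 + lam * B)%:E * (weights p lam s (vecs (Y ^~ w)) N)%:E))%E).
  apply: ge0_le_integral => //.
  - by move=> w _; exact: integral_ge0.
  - have mI := measurable_partial_integral (V := others_type Y i) P (mY i) mphi phi0.
    exact: (measurableT_comp mI (measurable_id_others mY (i := i))).
  - by under eq_fun do rewrite -EFinM; apply/measurable_EFinP; exact: measurable_funM.
  - move=> w _; rewrite /phi /=.
    under eq_integral => v _ do rewrite mulrC EFinM.
    rewrite ge0_integralZl_EFin //; last 3 first.
    + move=> v _; rewrite lee_fin; apply: le_trans (weight_ge1 _ _ _ lam0) => //.
    + apply/measurable_EFinP; apply: measurable_weight => j; last exact: measurable_cst.
      exact: measurable_tuple_entry.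
    + exact: weights_ge0.
    rewrite muleC; apply: lee_wpmul2r; first by rewrite lee_fin weights_ge0.
    apply: expect_weight; rewrite direction_norm.
    by case: (_ != _); [left|right].
rewrite ge0_integralZl_EFin //; last 2 first.
- by move=> w _; rewrite lee_fin weights_ge0.
- exact/measurable_EFinP.
by rewrite exprS EFinM lee_wpmul2l ?lee_fin // IH.
Qed.

End Moment.

(** * Counting integer vectors by a generating function *)

Section Count.
Context (R : realType).

(* Generating function: each code contributes at least [s ^+ a * t ^+ b] to the product of the sums. *)
Lemma card_codes (n D a b : nat) (s t : R) : 0 < s <= 1 -> 0 < t < 1 ->
  #|[set F : {ffun 'I_n -> 'I_D.+1} | (#|[set i | F i != ord0]%SET| <= a)%N && (\sum_i F i <= b)%N]%SET|%:R
    * (s ^+ a * t ^+ b) <= (1 + s * (t / (1 - t))) ^+ n.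
Proof.
move=> /andP[s0 s1] /andP[t0 t1].
pose g (k : 'I_D.+1) : R := if k == ord0 then 1 else s * t ^+ k.
have g0 k : 0 <= g k by rewrite /g; case: ifP => // _; rewrite mulr_ge0 ?exprn_ge0 ?ltW.
have gs : \sum_k g k <= 1 + s * (t / (1 - t)).
  rewrite big_ord_recl {1}/g eqxx lerD2l.
  have E (k : 'I_D) : g (lift ord0 k) = s * (t * t ^+ k) by rewrite /g /= exprS.
  rewrite (eq_bigr _ (fun k _ => E k)) -2!mulr_sumr ler_pM2l // ler_pM2l // geometric_le //.
  by rewrite ltW.
have gF (F : {ffun 'I_n -> 'I_D.+1}) :
    \prod_i g (F i) = s ^+ #|[set i | F i != ord0]%SET| * t ^+ \sum_i F i.
  rewrite -prodrXr -prodr_const [X in X * _]big_mkcond -big_split /=.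
  by apply: eq_bigr => i _; rewrite inE /g; case: eqVneq => [->|]; rewrite ?mul1r.
rewrite -sum1_card natr_sum mulr_suml.
apply: le_trans (_ : \sum_(F : {ffun 'I_n -> 'I_D.+1}) \prod_i g (F i) <= _); last first.
  rewrite -(bigA_distr_bigA (fun _ k => g k)) /= prodr_const card_ord lerXn2r ?nnegrE //.
  - by apply: sumr_ge0 => k _.
  - by rewrite addr_ge0 // !mulr_ge0 ?invr_ge0 ?subr_ge0 // ltW.
rewrite [leRHS](bigID (mem [set F : {ffun 'I_n -> 'I_D.+1} | (#|[set i | F i != ord0]%SET| <= a)%N && (\sum_i F i <= b)%N]%SET)) /=.
rewrite -[leLHS]addr0; apply: lerD; last by apply: sumr_ge0 => F _; exact: prodr_ge0.
apply: ler_sum => F; rewrite inE => /andP[Fa Fb]; rewrite gF mul1r.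
apply: ler_pM; rewrite ?exprn_ge0 ?(ltW s0) ?(ltW t0) //.
  by apply: ler_wiXn2l => //; exact: ltW.
by apply: ler_wiXn2l => //; exact: ltW.
Qed.

(** Zigzag enumeration of the integers: only [0] has code [0], so supports are preserved, and the
    code of [z] is at most twice its absolute value. *)
Definition int_code (z : int) : nat := match z with Posz m => m.*2 | Negz m => m.*2.+1 end.

Definition code_int (k : nat) : int := if odd k then Negz k./2 else Posz k./2.

Lemma int_codeK : cancel int_code code_int.
Proof.
by case=> m; rewrite /code_int /= odd_double /= ?doubleK ?uphalf_double.
Qed.

Lemma int_code_le (z : int) : (int_code z)%:R <= 2 * z%:~R ^+ 2 :> R.
Proof.
have h (m : nat) : m%:R <= m%:R ^+ 2 :> R.
  by rewrite -natrX ler_nat -mulnn; case: m => // m; rewrite leq_pmulr.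
case: z => m /=.
  by rewrite -pmulrn -muln2 natrM mulrC ler_pM2l.
rewrite NegzE mulrNz sqrrN -pmulrn; apply: le_trans (_ : 2 * m.+1%:R <= _); last by rewrite ler_pM2l.
by rewrite -natrM ler_nat mul2n doubleS.
Qed.

End Count.

(** * Union bound over integer vectors *)

Lemma markov_ge0 (R : realType) d (T : measurableType d) (P : probability T R) (W : T -> R) (t m : R) :
  measurable_fun setT W -> (forall w, 0 <= W w) -> 0 < t ->
  (\int[P]_w (W w)%:E <= m%:E)%E -> (P [set w | (t <= W w)%R] <= (m / t)%:E)%E.
Proof.
move=> mW W0 t0 hm.
have mE : measurable [set w | t <= W w].
  rewrite -[X in measurable X]setTI.
  exact: (measurable_fun_ler (measurable_cst t) mW measurableT (Y := [set true])).
rewrite EFinM muleC -lee_pdivrMl ?invr_gt0 // invrK.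
apply: le_trans hm; rewrite -(integral_cst P mE t%:E).
apply: (@le_trans _ _ (\int[P]_(w in [set w | (t <= W w)%R]) (W w)%:E)%E).
  apply: ge0_le_integral => //.
  - by move=> w _; rewrite lee_fin ltW.
  - by apply/measurable_EFinP; exact: measurable_funS mW.
apply: ge0_subset_integral => //.
- exact/measurable_EFinP.
- by move=> w _; rewrite lee_fin.
Qed.

Lemma finite_union_bound (R : realType) d (T : measurableType d) (P : probability T R) (I : eqType)
    (r : seq I) (E : I -> set T) (e : I -> R) :
  (forall i, i \in r -> measurable (E i)) -> (forall i, i \in r -> (P (E i) <= (e i)%:E)%E) ->
  exists Bad : set T, [/\ measurable Bad, (P Bad <= (\sum_(i <- r) e i)%:E)%E &
    forall i, i \in r -> E i `<=` Bad].
Proof.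
elim: r => [|i r IH] mE PE.
  by exists set0; split; rewrite ?big_nil ?measure0.
have [k kr|k kr|Bad [mB PB sB]] := IH.
- by apply: mE; rewrite inE kr orbT.
- by apply: PE; rewrite inE kr orbT.
have mEi : measurable (E i) by apply: mE; rewrite mem_head.
exists (E i `|` Bad); split.
- exact: measurableU.
- rewrite big_cons EFinD; apply: le_trans (measureU2 _ _ _) _ => //.
  by apply: leeD => //; apply: PE; rewrite mem_head.
- move=> k; rewrite inE => /orP[/eqP ->|/sB h]; first exact: subsetUl.
  by apply: subset_trans h _; exact: subsetUr.
Qed.

Lemma powR_sqr (R : realType) (x p : R) : `|x| `^ p = (x ^+ 2) `^ (p / 2).
Proof.
by rewrite -real_normK ?num_real // -powR_mulrn // -powRrM mulrC divfK.
Qed.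

(** Each counted column contributes a factor at least [lam] times the power [p / 2] of [s], and
    every other factor is at least [1]. *)
Lemma weights_large (R : realType) (n : nat) (p lam s : R) (Y : 'I_n -> 'I_n -> R) (N : 'I_n -> R) (l : nat) :
  let w := comb Y N in
  0 < p -> 0 <= lam -> 0 <= s -> 1 <= lam * s `^ (p / 2) ->
  (l <= #|[set i | ((N i == 0) && (s * dotp w w < dotp (Y i) w ^+ 2))%R]%SET|)%N ->
  (lam * s `^ (p / 2)) ^+ l <= weights p lam [seq i <- enum 'I_n | N i == 0] Y N.
Proof.
move=> w p0 lam0 s0 D1; set Top := [set i | _]%SET => lT.
rewrite /weights big_filter big_enum_cond /=.
have D0 := le_trans ler01 D1.
apply: le_trans (_ : (lam * s `^ (p / 2)) ^+ #|Top| <= _).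
  exact: ler_weXn2l.
rewrite -prodr_const [leRHS](bigID (mem Top)) /=.
have -> : \prod_(i < n | (N i == 0) && (i \in Top)) weight p lam (Y i) (direction Y N) =
          \prod_(i in Top) weight p lam (Y i) (direction Y N).
  by apply: eq_bigl => i; rewrite /= inE andbA andbb.
rewrite -[leLHS]mulr1; apply: ler_pM => //.
- by apply: prodr_ge0 => i _.
- apply: ler_prod => i; rewrite inE D0 /= => /andP[_ hi].
  rewrite /weight -[leLHS]add0r; apply: lerD => //; apply: ler_wpM2l => //.
  rewrite powR_sqr; apply: ge0_ler_powR; rewrite ?nnegrE ?sqr_ge0 //.
    by rewrite divr_ge0 // ltW.
  rewrite dotpZr exprMn.
  have a0 : 0 <= dotp w w := dotp_ge0 w.
  (* The strict inequality of [hi] excludes [w = 0], so that the direction is [w] divided by its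
     length. *)
  have an : dotp w w != 0.
    apply/eqP => h; move: hi; rewrite h mulr0.
    have w0 j : w j = 0.
      apply/eqP; rewrite -sqrf_eq0; move/eqP: h; rewrite sqr_dotp.
      by rewrite psumr_eq0 => [/allP/(_ j (mem_index_enum _))//|k _]; exact: sqr_ge0.
    by rewrite /dotp big1 => [|j _]; rewrite ?w0 ?mulr0 // expr0n ltxx.
  rewrite powRN powR12_sqrt // exprVn sqr_sqrtr //.
  by rewrite mulrC ler_pdivlMr ?lt_def ?an // ltW.
- apply: le_trans (_ : \prod_(i < n | (N i == 0) && (i \notin Top)) 1 <= _); first by rewrite big1_eq.
  by apply: ler_prod => i _; rewrite ler01 weight_ge1.
Qed.

Section SpreadLevel.
Context (R : realType) (n : nat) (p B lam : R) (p0 : 0 < p) (B0 : 0 <= B) (lam0 : 0 <= lam).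
Context (d : measure_display) (T : measurableType d) (P : probability T R)
  (Y : 'I_n -> T -> n.-tuple R).
Context (mY : forall i, measurable_fun setT (Y i)) (iY : independent_family P Y).
Context (momY : forall i (a : 'I_n -> R), dotp a a = 1 ->
  (\int[P]_w (`|dotp (vecs (Y ^~ w) i) a| `^ p)%:E <= B%:E)%E).

(** Markov's inequality for the weights of each coded integer vector, followed by a union bound over
    the codes. [Bad] is a measurable set containing every failure of spreading. *)
Lemma spread_level (a l b : nat) (s : R) : 0 <= s -> 1 <= lam * s `^ (p / 2) ->
  exists Bad : set T, [/\ measurable Bad,
    (P Bad <= (#|[set F : {ffun 'I_n -> 'I_(2 * b).+1} |
        (#|[set i | F i != ord0]%SET| <= a)%N && (\sum_i F i <= 2 * b)%N]%SET|%:R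
      * ((1 + lam * B) ^+ n / (lam * s `^ (p / 2)) ^+ l))%:E)%E &
    forall w, ~ Bad w -> spread (vecs (Y ^~ w)) a l b%:R s].
Proof.
move=> s0 D1.
set Good := [set F : {ffun 'I_n -> 'I_(2 * b).+1} | _]%SET.
pose dec (F : {ffun 'I_n -> 'I_(2 * b).+1}) (i : 'I_n) : R := (code_int (F i))%:~R.
pose W F w := weights p lam [seq i <- enum 'I_n | dec F i == 0] (vecs (Y ^~ w)) (dec F).
pose E F := [set w | (lam * s `^ (p / 2)) ^+ l <= W F w].
have mW F : measurable_fun setT (W F) by apply: measurable_weights.
have mE F : measurable (E F).
  rewrite -[X in measurable X]setTI.
  exact: (measurable_fun_ler (measurable_cst _) (mW F) measurableT (Y := [set true])).
have D0 : 0 < lam * s `^ (p / 2) by exact: lt_le_trans D1.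
have lB : 1 <= 1 + lam * B by rewrite lerDl mulr_ge0.
have PE F : (P (E F) <= ((1 + lam * B) ^+ n / (lam * s `^ (p / 2)) ^+ l)%:E)%E.
  apply: markov_ge0 => //; last 2 first.
  - exact: exprn_gt0.
  - apply: (@le_trans _ _ ((1 + lam * B) ^+ size [seq i <- enum 'I_n | dec F i == 0])%:E).
      apply: expect_weights => //; first by rewrite filter_uniq // enum_uniq.
      by move=> i; rewrite mem_filter => /andP[/eqP].
    rewrite lee_fin ler_weXn2l // size_filter; apply: leq_trans (count_size _ _) _.
    by rewrite size_enum_ord.
  - by move=> w; exact: weights_ge0.
have [Bad [mB PB sB]] := finite_union_bound (r := enum Good) (fun F _ => mE F) (fun F _ => PE F).
exists Bad; split => //.
- by move: PB; rewrite big_enum sumr_const -[_ *+ _]mulr_natl.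
- move=> w nB N Na Nb /=; rewrite ltnNge; apply/negP => lT; apply: nB.
  (* Each squared entry is at most [b], so its code fits into the finite range and [inord] does not
     truncate. *)
  have Nle i : (int_code (N i) <= 2 * b)%N.
    rewrite -(ler_nat R) natrM; apply: le_trans (int_code_le R (N i)) _; rewrite ler_pM2l //.
    apply: le_trans Nb; rewrite (bigD1 i) //= lerDl; apply: sumr_ge0 => j _; exact: sqr_ge0.
  pose F := [ffun i => inord (int_code (N i)) : 'I_(2 * b).+1].
  have FE i : F i = int_code (N i) :> nat by rewrite ffunE inordK // ltnS Nle.
  have decF i : dec F i = (N i)%:~R by rewrite /dec FE int_codeK.
  have GF : F \in Good.
    rewrite inE; apply/andP; split.
      apply: leq_trans Na; apply: subset_leq_card; apply/fintype.subsetP => i; rewrite !inE.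
      by apply: contraNneq => Ni; apply/eqP/val_inj; rewrite /= FE Ni.
    rewrite -(ler_nat R) natrM natr_sum.
    apply: le_trans (_ : \sum_i 2 * (N i)%:~R ^+ 2 <= _).
      by apply: ler_sum => i _; rewrite FE int_code_le.
    by rewrite -mulr_sumr ler_pM2l.
  apply: (sB F); first by rewrite mem_enum.
  rewrite /E /= /W.
  have wc : comb (vecs (Y ^~ w)) (dec F) =1 comb (vecs (Y ^~ w)) (fun i => (N i)%:~R).
    by apply: eq_comb.
  apply: weights_large => //; apply: leq_trans lT _; apply: subset_leq_card; apply/fintype.subsetP => i.
  rewrite !inE decF intr_eq0 => /andP[-> /=].
  by rewrite (eq_dotp wc wc) (eq_dotp (fun=> erefl) wc).
Qed.

End SpreadLevel.

(** * Numerical estimates for the union bound *)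

Section Numeric.
Context (R : realType).

Lemma expn_le_expR (x : R) (m : nat) : 0 <= x -> (1 + x) ^+ m <= expR (m%:R * x).
Proof.
move=> x0; rewrite expRM_natl; apply: lerXn2r; rewrite ?nnegrE ?expR_ge0 ?addr_ge0 //.
exact: expR_ge1Dx.
Qed.

Lemma card_codes_level (n U u c : nat) (rho : R) :
  (n <= 2 ^ U)%N -> (c <= u <= U)%N -> 1 <= rho -> 4 <= rho ^+ (2 ^ c) ->
  let b := (2 ^ (u - c) * 2 ^ (6 + (U - u)))%N in
  #|[set F : {ffun 'I_n -> 'I_(2 * b).+1} |
      (#|[set i | F i != ord0]%SET| <= 2 ^ (u - c))%N && (\sum_i F i <= 2 * b)%N]%SET|%:R
  <= (64 * expR 3 * rho ^+ (U - u)) ^+ (2 ^ u).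
Proof.
move=> nU /andP[cu uU] rho1 rho4; cbv zeta; set b := (2 ^ (u - c) * 2 ^ (6 + (U - u)))%N.
set v := (U - u)%N; set a := (2 ^ (u - c))%N; set l := (2 ^ u)%N.
pose Q : R := 2 ^+ (6 + v).
have two0 k : 0 < 2 ^+ k :> R by rewrite exprn_gt0.
have Q0 : 0 < Q by exact: two0.
have Q1 : 1 <= Q by rewrite exprn_ege1 // ler1n.
(* Chosen so that [s * (t / (1 - t))] is the inverse of [2 ^+ v]. As [b = a * Q] and [a <= l], the
   inverse of [t ^+ (2 * b)] is at most [expR 2 ^+ l]. *)
pose s := (2 ^+ v * Q)^-1; pose t := Q / (1 + Q).
have s01 : 0 < s <= 1.
  have q0 : 0 < 2 ^+ v * Q by rewrite mulr_gt0.
  by rewrite invr_gt0 q0 /= invf_le1 // mulr_ege1 // exprn_ege1 // ler1n.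
have t01 : 0 < t < 1.
  by rewrite divr_gt0 ?addr_gt0 //= ltr_pdivrMr ?addr_gt0 // mul1r ltrDr.
have h := @card_codes R n (2 * b) a (2 * b) s t s01 t01.
set G := _%:R in h *.
have st0 : 0 < s ^+ a * t ^+ (2 * b).
  by case/andP: s01 => s0 _; case/andP: t01 => t0 _; rewrite mulr_gt0 // exprn_gt0.
rewrite -(ler_pM2r st0). apply: le_trans h _.
have al : (a <= l)%N by rewrite /a /l leq_exp2l // leq_subr.
have E1 : (1 + s * (t / (1 - t))) ^+ n <= expR 1 ^+ l.
  have -> : s * (t / (1 - t)) = (2 ^+ v)^-1.
    have -> : 1 - t = (1 + Q)^-1 by rewrite /t; field; rewrite gt_eqF ?addr_gt0.
    by rewrite /s /t; field; rewrite !gt_eqF ?addr_gt0.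
  have v0 : 0 <= (2 ^+ v)^-1 :> R by rewrite invr_ge0 ltW.
  apply: le_trans (expn_le_expR _ v0) _.
  rewrite -expRM_natl mulr1 ler_expR ler_pdivrMr // -!natrX -natrM ler_nat /l -expnD.
  by rewrite addnC subnK.
have E2 : 1 <= expR 2 ^+ l * t ^+ (2 * b).
  rewrite -ler_pdivrMr ?exprn_gt0 //; last by case/andP: t01.
  have -> : 1 / t ^+ (2 * b) = (1 + Q^-1) ^+ (2 * b).
    by rewrite mul1r -exprVn; congr (_ ^+ _); rewrite /t; field; rewrite !gt_eqF ?addr_gt0.
  have v0 : 0 <= Q^-1 by rewrite invr_ge0 ltW.
  apply: le_trans (expn_le_expR _ v0) _.
  rewrite -expRM_natl ler_expR ler_pdivrMr //.
  have -> : Q = (2 ^ (6 + v))%N%:R by rewrite natrX.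
  have -> : l%:R * 2 * (2 ^ (6 + v))%N%:R = (l * 2 * 2 ^ (6 + v))%N%:R :> R by rewrite !natrM.
  rewrite ler_nat /b -/v -/a mulnA (mulnC 2); by rewrite !leq_mul.
(* Each support element costs [64 * 4 ^+ v]; since [l = 2 ^ c * a], the hypothesis on [rho] spreads
   this cost over [2 ^ c] factors [rho ^+ v]. *)
have E3 : 1 <= (64 * rho ^+ v) ^+ l * s ^+ a.
  have -> : s ^+ a = ((64 * 4 ^+ v) ^+ a)^-1.
    rewrite -exprVn /s; congr (_^-1 ^+ _); rewrite /Q exprD mulrCA -exprMn.
    by rewrite -[2 ^+ 6]natrX -natrM.
  rewrite ler_pdivlMr ?mul1r; last by rewrite exprn_gt0 // mulr_gt0 // exprn_gt0.
  have -> : l = (2 ^ c * a)%N by rewrite /l /a -expnD subnKC.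
  rewrite !exprMn; apply: ler_pM; rewrite ?exprn_ge0 //.
    by rewrite ler_weXn2l // ?ler1n // leq_pmull // expn_gt0.
  have -> : (rho ^+ v) ^+ (2 ^ c * a) = ((rho ^+ (2 ^ c)) ^+ v) ^+ a.
    by rewrite -!exprM; congr (_ ^+ _); rewrite mulnCA mulnA.
  by rewrite !lerXn2r ?nnegrE ?exprn_ge0 // (le_trans ler01).
have -> : (64 * expR 3 * rho ^+ v) ^+ l * (s ^+ a * t ^+ (2 * b)) =
    expR 1 ^+ l * ((expR 2 ^+ l * t ^+ (2 * b)) * ((64 * rho ^+ v) ^+ l * s ^+ a)).
  have -> : expR 3 = expR 1 * expR 2 :> R by rewrite -expRD; congr expR; ring.
  by rewrite !exprMn; ring.
apply: le_trans E1 _; rewrite -[leLHS]mulr1; apply: ler_wpM2l; first by rewrite exprn_ge0 // expR_ge0.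
exact: mulr_ege1.
Qed.

Lemma gt1_ltr_powR (a x y : R) : 1 < a -> x < y -> a `^ x < a `^ y.
Proof.
move=> a1 xy; rewrite /powR gt_eqF; last exact: lt_trans a1.
by rewrite ltr_expR ltr_pM2r // ln_gt0.
Qed.

(* [spread_sig p < 2] keeps the thresholds [K * sig ^+ v] summable against [2 ^+ u], and
   [spread_sig p `^ (p / 2) = 2 * spread_rho p ^+ 2 > 2] makes the tail bounds beat the union bound. *)
Definition spread_rho (p : R) : R := 2 `^ ((p - 2) / 8).
Definition spread_sig (p : R) : R := (2 * spread_rho p ^+ 2) `^ (2 / p).
(** [64 * expR 3] cancels the number of codes, [expR B] cancels the moments, and [16] is the margin
    that makes the levels summable. *)
Definition spread_kappa (B : R) : R := 64 * 16 * expR (3 + B).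

Lemma spread_rho_gt1 (p : R) : 2 < p -> 1 < spread_rho p.
Proof.
move=> p2; rewrite -(powRr0 2) /spread_rho; apply: gt1_ltr_powR; first by rewrite ltr1n.
by rewrite divr_gt0 // subr_gt0.
Qed.

(** [spread_sig p] is [2] to the power [(p + 2) / (2 * p)], and this exponent is below [1] because
    [p > 2]. *)
Lemma spread_sig_lt2 (p : R) : 2 < p -> spread_sig p < 2.
Proof.
move=> p2; have p0 : 0 < p by exact: lt_trans p2.
rewrite /spread_sig; have -> : 2 * spread_rho p ^+ 2 = 2 `^ (1 + (p - 2) / 4) :> R.
  rewrite powRD ?pnatr_eq0 ?implybT // powRr1 // /spread_rho -powR_mulrn ?powR_ge0 // -powRrM.
  by congr (_ * _ `^ _); field.
rewrite -powRrM -[ltRHS]powRr1 //; apply: gt1_ltr_powR; first by rewrite ltr1n.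
by rewrite mulrA ltr_pdivrMr // mul1r; lra.
Qed.

Lemma spread_exponent (p : R) : 2 < p -> exists c, 4 <= spread_rho p ^+ (2 ^ c).
Proof.
(* [2 ^ c] must reach [16 / (p - 2)] for the exponent [2 ^ c * (p - 2) / 8] of [2] to reach [2]. *)
move=> p2; pose c := (Num.truncn (16 / (p - 2))).+1; exists c.
have pp : 0 < p - 2 by rewrite subr_gt0.
have hc : 16 / (p - 2) <= (2 ^ c)%N%:R.
  apply: le_trans (ltW (truncnS_gt _)) _.
  by rewrite ler_nat ltnW // ltn_expl.
have -> : 4 = 2 `^ 2%:R :> R by rewrite powR_mulrn // -natrX.
rewrite /spread_rho -powR_mulrn ?powR_ge0 // -powRrM; apply: ler_powR; first by rewrite ler1n.
by move: hc; rewrite ler_pdivrMr // ; lra.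
Qed.

(** After cancellation the inverse of the left side is at least [16 ^+ l * (rho ^+ l) ^+ v]. Here
    [16 ^+ l >= 16 ^+ u] and [rho ^+ l >= 4], while [16 ^+ u * 4 ^+ v = 4 ^+ U * 4 ^+ u]. *)
Lemma level_probability (n U u c : nat) (p B : R) : 2 < p -> 0 <= B ->
  (n <= 2 ^ U)%N -> (c <= u <= U)%N -> 4 <= spread_rho p ^+ (2 ^ c) ->
  (64 * expR 3 * spread_rho p ^+ (U - u)) ^+ (2 ^ u) *
   ((1 + (2 ^+ (U - u))^-1 * B) ^+ n /
     (spread_kappa B * spread_rho p ^+ 2 ^+ (U - u)) ^+ (2 ^ u)) <= (4 ^+ U * 4 ^+ u)^-1.
Proof.
move=> p2 B0 nU /andP[cu uU] rho4.
have rho1 := spread_rho_gt1 p2; set rho := spread_rho p in rho1 rho4 *.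
have rho0 : 0 < rho by exact: lt_trans rho1.
set v := (U - u)%N; set l := (2 ^ u)%N.
have two0 k : 0 < 2 ^+ k :> R by rewrite exprn_gt0.
have v0 : 0 <= (2 ^+ v)^-1 * B by rewrite mulr_ge0 // invr_ge0 ltW.
have E1 : (1 + (2 ^+ v)^-1 * B) ^+ n <= expR B ^+ l.
  apply: le_trans (expn_le_expR _ v0) _.
  rewrite -expRM_natl ler_expR mulrA; apply: ler_wpM2r => //.
  by rewrite ler_pdivrMr // -natrX -natrM ler_nat /l -expnD addnC subnK.
have kap0 : 0 < spread_kappa B by rewrite mulr_gt0 // expR_gt0.
have den0 : 0 < (spread_kappa B * rho ^+ 2 ^+ v) ^+ l.
  by rewrite exprn_gt0 // mulr_gt0 // exprn_gt0 // exprn_gt0.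
rewrite mulrA ler_pdivrMr //.
apply: le_trans (_ : (64 * expR 3 * rho ^+ v) ^+ l * expR B ^+ l <= _).
  by apply: ler_wpM2l => //; rewrite exprn_ge0 // mulr_ge0 ?mulr_ge0 ?expR_ge0 ?exprn_ge0 ?ltW.
have -> : (spread_kappa B * rho ^+ 2 ^+ v) ^+ l =
    (64 * expR 3 * rho ^+ v) ^+ l * expR B ^+ l * (16 ^+ l * (rho ^+ l) ^+ v).
  rewrite /spread_kappa expRD -[(rho ^+ l) ^+ v]exprM mulnC exprM -!exprMn; congr (_ ^+ _).
  by rewrite -[rho ^+ 2 ^+ v]exprM mul2n -addnn exprD; ring.
rewrite [leRHS]mulrC -[leRHS]mulrA; apply: ler_peMr.
  by rewrite mulr_ge0 ?exprn_ge0 ?mulr_ge0 ?expR_ge0 ?exprn_ge0 ?ltW.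
rewrite ler_pdivlMr ?mul1r ?mulr_gt0 ?exprn_gt0 //.
have -> : 4 ^+ U * 4 ^+ u = 16 ^+ u * 4 ^+ v :> R.
  have -> : 16 = 4 * 4 :> R by rewrite -natrM.
  by rewrite -(subnKC uU) exprD exprMn -/v; ring.
apply: ler_pM; rewrite ?exprn_ge0 //.
  by rewrite ler_weXn2l ?ler1n // ltnW // ltn_expl.
apply: lerXn2r; rewrite ?nnegrE ?exprn_ge0 ?(ltW rho0) //.
by apply: le_trans rho4 _; rewrite ler_weXn2l ?(ltW rho1) // leq_exp2l.
Qed.

End Numeric.

(** * Spreading at all levels with high probability *)

Section SpreadWhp.
Context (R : realType) (p B : R) (p2 : 2 < p) (B0 : 0 <= B).

Definition spread_K : R := spread_kappa B `^ (2 / p).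

(** The power [p / 2] undoes the exponent [2 / p] in [spread_K] and [spread_sig]; the resulting
    [2 ^+ v] is cancelled by [lam]. *)
Lemma spread_threshold (v : nat) :
  (2 ^+ v)^-1 * (spread_K * spread_sig p ^+ v) `^ (p / 2) = spread_kappa B * spread_rho p ^+ 2 ^+ v.
Proof.
have p0 : 0 < p by exact: lt_trans p2.
have rho0 : 0 < spread_rho p by apply: lt_trans (spread_rho_gt1 p2).
have e : 2 / p * (p / 2) = 1 :> R by field; rewrite gt_eqF.
have kap0 : 0 <= spread_kappa B by rewrite mulr_ge0 // expR_ge0.
have eK : spread_K `^ (p / 2) = spread_kappa B.
  rewrite /spread_K -powRrM.
  by rewrite e powRr1.
rewrite powRM ?powR_ge0 ?exprn_ge0 ?powR_ge0 // eK.
have eS : spread_sig p `^ (p / 2) = 2 * spread_rho p ^+ 2.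
  by rewrite /spread_sig -powRrM e powRr1 // mulr_ge0 // exprn_ge0 // ltW.
rewrite -powR_mulrn ?powR_ge0 // powRAC eS powR_mulrn; last by rewrite mulr_ge0 // exprn_ge0 // ltW.
by rewrite exprMn mulrCA [in X in _ * X]mulrA mulVf ?mul1r // expf_neq0 // pnatr_eq0.
Qed.

Lemma spread_whp (c n U : nat) (d : measure_display) (T : measurableType d) (P : probability T R)
    (Y : 'I_n -> T -> n.-tuple R) :
  4 <= spread_rho p ^+ (2 ^ c) -> (n <= 2 ^ U)%N ->
  (forall i, measurable_fun setT (Y i)) -> independent_family P Y ->
  (forall i (a : 'I_n -> R), dotp a a = 1 ->
    (\int[P]_w (`|dotp (vecs (Y ^~ w) i) a| `^ p)%:E <= B%:E)%E) ->
  exists Bad : set T, [/\ measurable Bad, (P Bad <= (2 / 4 ^+ U)%:E)%E &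
    forall w, ~ Bad w -> forall u, (c <= u <= U)%N ->
      spread (vecs (Y ^~ w)) (2 ^ (u - c)) (2 ^ u) ((2 ^ (u - c) * 2 ^ (6 + (U - u)))%N%:R)
        (spread_K * spread_sig p ^+ (U - u))].
Proof.
move=> rho4 nU mY iY momY.
have p0 : 0 < p by exact: lt_trans p2.
have rho1 := spread_rho_gt1 p2.
have kap1 : 1 <= spread_kappa B.
  rewrite /spread_kappa mulr_ege1 //; first by rewrite -natrM ler1n.
  by apply: le_trans (expR_ge1Dx _); rewrite lerDl addr_ge0.
(* The range of [u] sits inside the existential so that [choice] yields a family indexed by all
   natural numbers. *)
have level u : exists Bad : set T, (c <= u <= U)%N ->
    [/\ measurable Bad, (P Bad <= ((4 ^+ U * 4 ^+ u)^-1)%:E)%E &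
     forall w, ~ Bad w -> spread (vecs (Y ^~ w)) (2 ^ (u - c)) (2 ^ u)
       ((2 ^ (u - c) * 2 ^ (6 + (U - u)))%N%:R) (spread_K * spread_sig p ^+ (U - u))].
  have [cuU|_] := boolP (c <= u <= U)%N; last by exists set0.
  have lam0 : 0 <= (2 ^+ (U - u))^-1 :> R by rewrite invr_ge0 exprn_ge0.
  have s0 : 0 <= spread_K * spread_sig p ^+ (U - u).
    by rewrite mulr_ge0 ?exprn_ge0 ?powR_ge0.
  have D1 : 1 <= (2 ^+ (U - u))^-1 * (spread_K * spread_sig p ^+ (U - u)) `^ (p / 2).
    by rewrite spread_threshold mulr_ege1 // exprn_ege1 // exprn_ege1 // ltW.
  have [Bad [mB PB sB]] := spread_level p0 B0 lam0 mY iY momY (2 ^ (u - c)) (2 ^ u)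
    (2 ^ (u - c) * 2 ^ (6 + (U - u))) s0 D1.
  exists Bad => _; split => //; apply: le_trans PB _; rewrite lee_fin spread_threshold.
  apply: le_trans (level_probability p2 B0 nU cuU rho4).
  apply: ler_wpM2r; last exact: card_codes_level nU cuU (ltW rho1) rho4.
  apply: divr_ge0; apply: exprn_ge0; first by rewrite addr_ge0 // mulr_ge0.
  by rewrite mulr_ge0 ?(le_trans ler01 kap1) // exprn_ge0 // exprn_ge0 // ltW // (lt_trans ltr01).
have [E hE] := choice level.
have rng u : u \in index_iota c U.+1 -> (c <= u <= U)%N by rewrite mem_index_iota.
have [|u ur|Bad [mB PB sB]] := @finite_union_bound _ _ _ P _ (index_iota c U.+1) E
  (fun u => (4 ^+ U * 4 ^+ u)^-1).
- by move=> u /rng /hE [].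
- by have [] := hE u (rng u ur).
exists Bad; split => //; last first.
  move=> w nB u cuU; have [_ _] := hE u cuU; apply => Ew; apply: nB.
  by apply: (sB u) => //; rewrite mem_index_iota.
apply: le_trans PB _; rewrite lee_fin.
have inv u : (4 ^+ U * 4 ^+ u)^-1 = 4^-1 ^+ u / 4 ^+ U :> R by rewrite invfM mulrC exprVn.
under eq_bigr do rewrite inv.
rewrite -mulr_suml ler_pM2r ?invr_gt0 ?exprn_gt0 //.
(* The levels sum to at most [4 / 3], below the announced [2]. *)
have q01 : 0 <= (4^-1 : R) < 1 by apply/andP; split; lra.
apply: le_trans (_ : \sum_(u < U.+1) 4^-1 ^+ u <= _).
  rewrite -(big_mkord xpredT (fun u => 4^-1 ^+ u)).
  have [cU|Uc] := leqP c U.+1; last by rewrite (big_geq (ltnW Uc)) sumr_ge0 // => i _; rewrite exprn_ge0.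
  rewrite [leRHS](big_cat_nat (leq0n c) cU) /= lerDr; apply: sumr_ge0 => i _; exact: exprn_ge0.
apply: le_trans (geometric_le _ q01) _.
have -> : 1 - 4^-1 = 3 / 4 :> R by field.
by rewrite invf_div; lra.
Qed.
End SpreadWhp.

(** * A long column *)

Section LongVector.
Context (R : realType) (p B : R) (p2 : 2 < p) (B1 : 1 <= B).

(** The value whose power [(p - 2) / 2] is [4 * B]: if [x ^+ 2] exceeds it, then [x ^+ 2] is at most
    the [p]-th power of the absolute value of [x] divided by [4 * B]. *)
Definition truncation_level : R := (4 * B) `^ (2 / (p - 2)).

Lemma truncation_level_ge1 : 1 <= truncation_level.
Proof.
apply: le_trans (_ : 1 `^ (2 / (p - 2)) <= _); first by rewrite powR1.
apply: ge0_ler_powR; rewrite ?nnegrE //.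
- by rewrite divr_ge0 // subr_ge0 ltW.
- by rewrite mulr_ge0 // (le_trans ler01).
- move: B1; lra.
Qed.

Lemma sqr_le_truncation (x : R) :
  x ^+ 2 <= Num.min (x ^+ 2) truncation_level + `|x| `^ p / (4 * B).
Proof.
have B0 : 0 < B by exact: lt_le_trans B1.
have [h|h] := leP (x ^+ 2) truncation_level.
  by rewrite lerDl divr_ge0 ?powR_ge0 // mulr_ge0 // ltW.
have T0 : 0 < truncation_level by exact: lt_le_trans truncation_level_ge1.
have x0 : 0 < x ^+ 2 by exact: lt_trans h.
apply: le_trans (_ : `|x| `^ p / (4 * B) <= _); last by rewrite lerDr ltW.
rewrite ler_pdivlMr ?mulr_gt0 // powR_sqr.
have -> : p / 2 = 1 + (p - 2) / 2 by field.
rewrite powRD; last by rewrite (gt_eqF x0) implybT.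
rewrite powRr1 ?(ltW x0) // ler_pM2l //.
have -> : 4 * B = truncation_level `^ ((p - 2) / 2).
  rewrite /truncation_level -powRrM.
  have -> : 2 / (p - 2) * ((p - 2) / 2) = 1 by field; rewrite subr_eq0 gt_eqF.
  by rewrite powRr1 // mulr_ge0 // ltW.
apply: ge0_ler_powR; rewrite ?nnegrE ?(ltW T0) ?(ltW x0) ?(ltW h) //.
by rewrite divr_ge0 // subr_ge0 ltW.
Qed.

Context (n : nat) (d : measure_display) (T : measurableType d) (P : probability T R).

(** The squared length has mean [n]. Short vectors account for at most [n / 2] of it and large
    entries for at most [n / 4], so truncated entries on [G] must supply [n / 4] while being at most
    [n * tau]. *)
Lemma long_vector_prob (y : T -> n.-tuple R) : (0 < n)%N -> measurable_fun setT y ->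
  (forall j, (\int[P]_w (tnth (y w) j ^+ 2)%:E = 1)%E) ->
  (forall j, (\int[P]_w (`|tnth (y w) j| `^ p)%:E <= B%:E)%E) ->
  ((4 * truncation_level)^-1%:E <= P [set w | (n%:R / 2 <= \sum_j tnth (y w) j ^+ 2)%R])%E.
Proof.
move=> n0 my y2 yp.
set tau := truncation_level; have tau1 := truncation_level_ge1.
set G := [set w | _].
have B0 : 0 < B by exact: lt_le_trans B1.
have nR : 0 < n%:R :> R by rewrite ltr0n.
have mj j := measurable_tuple_entry j my.
have mj2 j : measurable_fun setT (fun w => tnth (y w) j ^+ 2) by exact: measurable_funX.
have mjp j : measurable_fun setT (fun w => `|tnth (y w) j| `^ p).
  apply: (measurableT_comp (measurable_powR _)).
  exact: (measurableT_comp (@normr_measurable _ _)).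
have mS : measurable_fun setT (fun w => \sum_j tnth (y w) j ^+ 2) by exact: measurable_sum.
have mG : measurable G.
  rewrite -[X in measurable X]setTI.
  exact: (measurable_fun_ler (measurable_cst _) mS measurableT (Y := [set true])).
have fG : P G \is a fin_num by rewrite fin_num_measure.
(* The sum of truncated squares is at most [n * tau] always, and at most [n / 2] off [G]. *)
pose F w := n%:R / 2 + n%:R * tau * \1_G w + \sum_j `|tnth (y w) j| `^ p / (4 * B).
have SF w : \sum_j tnth (y w) j ^+ 2 <= F w.
  apply: le_trans (ler_sum _ (fun j _ => sqr_le_truncation (tnth (y w) j))) _.
  rewrite big_split /= lerD2r /F.
  have m1 : \sum_(j < n) Num.min (tnth (y w) j ^+ 2) tau <= n%:R * tau.
    rewrite -[n in leRHS]card_ord; apply: sum_card_le => j _; by rewrite ge_min lexx orbT.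
  have m2 : \sum_(j < n) Num.min (tnth (y w) j ^+ 2) tau <= \sum_j tnth (y w) j ^+ 2.
    by apply: ler_sum => j _; by rewrite ge_min lexx.
  rewrite indicE; have [wG|wG] := boolP (w \in G).
    by rewrite mulr1; move: m1; rewrite -/tau; lra.
  rewrite mulr0 addr0; apply: le_trans m2 _; rewrite leNgt; apply: contra wG => /ltW h.
  by rewrite inE.
have mF : measurable_fun setT F.
  apply: measurable_funD; last by apply: measurable_sum => j; exact: measurable_funM.
  apply: measurable_funD; first exact: measurable_cst.
  apply: measurable_funM; first exact: measurable_cst.
  exact: measurable_indic.
have ES : (\int[P]_w (\sum_j tnth (y w) j ^+ 2)%:E = n%:R%:E)%E.
  under eq_integral do rewrite -sumEFin.
  rewrite ge0_integral_sum //; last 2 first.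
  - by move=> j; exact/measurable_EFinP.
  - by move=> j w _; rewrite lee_fin sqr_ge0.
  rewrite (eq_bigr (fun=> 1%:E)) //; by rewrite sumEFin sumr_const card_ord.
have EF : (\int[P]_w (F w)%:E <= (n%:R / 2 + n%:R * tau * fine (P G) + n%:R / 4)%:E)%E.
  have c0 : 0 <= n%:R * tau by rewrite mulr_ge0 // (le_trans ler01).
  have mInd : measurable_fun setT (\1_G : T -> R) by exact: measurable_indic.
  have i0 w : 0 <= \1_G w :> R by rewrite indicE.
  have m1 : measurable_fun setT (fun w => (n%:R / 2)%:E + (n%:R * tau * \1_G w)%:E)%E.
    apply/measurable_EFinP; apply: measurable_funD; first exact: measurable_cst.
    by apply: measurable_funM; [exact: measurable_cst|].
  have m2 : measurable_fun setT (fun w => (\sum_j `|tnth (y w) j| `^ p / (4 * B))%:E).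
    by apply/measurable_EFinP; apply: measurable_sum => j; exact: measurable_funM.
  have m3 : measurable_fun setT (fun w => (n%:R * tau * \1_G w)%:E).
    by apply/measurable_EFinP; apply: measurable_funM; [exact: measurable_cst|].
  have p1 w : setT w -> (0 <= (n%:R / 2)%:E + (n%:R * tau * \1_G w)%:E)%E.
    by move=> _; rewrite -EFinD lee_fin addr_ge0 ?divr_ge0 // mulr_ge0.
  have p2' w : setT w -> (0 <= (\sum_j `|tnth (y w) j| `^ p / (4 * B))%:E)%E.
    move=> _; rewrite lee_fin; apply: sumr_ge0 => j _.
    by rewrite divr_ge0 ?powR_ge0 // mulr_ge0 // ltW.
  have p3 w : setT w -> (0 <= (n%:R * tau * \1_G w)%:E)%E.
    by move=> _; rewrite lee_fin mulr_ge0.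
  under eq_integral do rewrite /F !EFinD.
  rewrite (ge0_integralD P measurableT p1 m1 p2' m2) EFinD; apply: leeD.
    rewrite (ge0_integralD P measurableT (f1 := cst (n%:R / 2)%:E) _ _ p3 m3) //; last first.
      by move=> w _; rewrite lee_fin divr_ge0.
    rewrite EFinD; apply: leeD.
      by rewrite (integral_cst P measurableT (n%:R / 2)%:E) [X in (_ * X)%E]probability_setT mule1.
    under eq_integral do rewrite EFinM.
    rewrite ge0_integralZl_EFin //; last exact/measurable_EFinP.
    by rewrite integral_indic // setIT [in leRHS]EFinM fineK.
  under eq_integral do rewrite -sumEFin.
  rewrite ge0_integral_sum //; last 2 first.
  - by move=> j; apply/measurable_EFinP; exact: measurable_funM.
  - by move=> j w _; rewrite lee_fin divr_ge0 ?powR_ge0 // mulr_ge0 // ltW.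
  have Ej j : (\int[P]_w (`|tnth (y w) j| `^ p / (4 * B))%:E <= (4^-1)%:E)%E.
    under eq_integral do rewrite mulrC EFinM.
    have B4 : 0 < (4 * B)^-1 by rewrite invr_gt0 mulr_gt0.
    rewrite ge0_integralZl_EFin ?(ltW B4) //; last exact/measurable_EFinP.
    apply: (@le_trans _ _ (((4 * B)^-1)%:E * B%:E)%E).
      by apply: lee_wpmul2l => //; rewrite lee_fin ltW.
    by rewrite -EFinM lee_fin invfM -mulrA mulVf ?mulr1 // gt_eqF.
  apply: (@le_trans _ _ (\sum_(j < n) (4^-1)%:E)%E); first exact: lee_sum.
  by rewrite sumEFin sumr_const card_ord lee_fin -[_ *+ n]mulr_natl.
have : (n%:R%:E <= (n%:R / 2 + n%:R * tau * fine (P G) + n%:R / 4)%:E :> \bar R)%E.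
  rewrite -ES; apply: le_trans EF; apply: ge0_le_integral => //.
  - by move=> w _; rewrite lee_fin; apply: sumr_ge0 => j _; exact: sqr_ge0.
  - exact/measurable_EFinP.
  - exact/measurable_EFinP.
  - by move=> w _; rewrite lee_fin.
rewrite -(fineK fG) !lee_fin => h.
rewrite -[X in X <= _]mul1r ler_pdivrMr; last by rewrite mulr_gt0 // (lt_le_trans ltr01).
have : n%:R * 1 <= n%:R * (2^-1 + tau * fine (P G) + 4^-1) by move: h; lra.
by rewrite ler_pM2l //; lra.
Qed.
Lemma long_vector_whp (Y : 'I_n -> T -> n.-tuple R) : (0 < n)%N ->
  (forall i, measurable_fun setT (Y i)) -> independent_family P Y ->
  (forall i j, (\int[P]_w (tnth (Y i w) j ^+ 2)%:E = 1)%E) ->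
  (forall i j, (\int[P]_w (`|tnth (Y i w) j| `^ p)%:E <= B%:E)%E) ->
  exists Bad : set T, [/\ measurable Bad,
    (P Bad <= ((1 - (4 * truncation_level)^-1) ^+ n)%:E)%E &
    forall w, ~ Bad w -> exists i, n%:R / 2 <= \sum_j tnth (Y i w) j ^+ 2].
Proof.
move=> n0 mY iY Y2 Yp.
pose S := [set t : n.-tuple R | (\sum_j tnth t j ^+ 2 < n%:R / 2)%R].
have mS : measurable S.
  rewrite -[X in measurable X]setTI.
  have mf : measurable_fun setT (fun t : n.-tuple R => \sum_j tnth t j ^+ 2).
    by apply: measurable_sum => j; apply: measurable_funX; exact: measurable_tnth.
  exact: (measurable_fun_ltr mf (measurable_cst _) measurableT (Y := [set true])).
have mYS i : measurable (Y i @^-1` S).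
  by rewrite -[X in measurable X]setTI; exact: mY.
have mG i : measurable [set w | (n%:R / 2 <= \sum_j tnth (Y i w) j ^+ 2)%R].
  rewrite -[X in measurable X]setTI.
  have mf : measurable_fun setT (fun w => \sum_j tnth (Y i w) j ^+ 2).
    by apply: measurable_sum => j; apply: measurable_funX; exact: measurable_tuple_entry.
  exact: (measurable_fun_ler (measurable_cst _) mf measurableT (Y := [set true])).
exists (\bigcap_i (Y i @^-1` S)); split.
- exact: fin_bigcap_measurable.
- rewrite indep_rect // lee_fin -[n in leRHS]card_ord -prodr_const.
  apply: ler_prod => i _; rewrite fine_ge0 //=.
  have -> : Y i @^-1` S = ~` [set w | (n%:R / 2 <= \sum_j tnth (Y i w) j ^+ 2)%R].
    apply/seteqP; split=> w; rewrite /S /= ltNge; first by move=> /negP.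
    by move=> h; apply/negP.
  rewrite probability_setC //.
  have := long_vector_prob n0 (mY i) (Y2 i) (Yp i).
  have fG := fin_num_measure P _ (mG i).
  by rewrite -(fineK fG) -EFinB /= lerD2l lerN2 -lee_fin fineK.
- move=> w nB; apply: contrapT => h; apply: nB => i _; rewrite /S /= ltNge.
  by apply/negP => hi; apply: h; exists i.
Qed.

End LongVector.

(** The left side is at most [expR (- (n * dl))], and [expR (n * dl)] is the square of
    [expR (n * dl / 2)], hence at least [(n * dl / 2) ^+ 2 >= n]. *)
Lemma geometric_decay (R : realType) (dl : R) (n : nat) : 0 < dl <= 1 -> 4 / dl ^+ 2 <= n%:R -> (0 < n)%N ->
  (1 - dl) ^+ n <= n%:R^-1.
Proof.
move=> /andP[d0 d1] hn n0; have nR : 0 < n%:R :> R by rewrite ltr0n.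
apply: le_trans (_ : expR (- dl) ^+ n <= _).
  by rewrite lerXn2r ?nnegrE ?subr_ge0 ?expR_ge0 // expR_ge1Dx.
rewrite expRN exprVn lef_pV2 ?posrE ?exprn_gt0 ?expR_gt0 //.
rewrite -expRM_natl.
have -> : n%:R * dl = 2%:R * (n%:R * dl / 2) by field.
rewrite expRM_natl; have := expR_ge1Dx (n%:R * dl / 2).
have nd : 0 < n%:R * dl by rewrite mulr_gt0.
set x := n%:R * dl / 2 => hx.
apply: le_trans (_ : x ^+ 2 <= _); last first.
  rewrite lerXn2r ?nnegrE ?expR_ge0 ?divr_ge0 ?(ltW nd) //; move: hx; lra.
move: hn; rewrite ler_pdivrMr ?exprn_gt0 // => hn.
rewrite /x; have -> : (n%:R * dl / 2) ^+ 2 = n%:R * (n%:R * dl ^+ 2 / 4) by field.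
by rewrite -[leLHS]mulr1 ler_pM2l //; move: hn; lra.
Qed.

(** * The spectral norm *)

Section Duality.
Context (R : realFieldType) (n d : nat) (Y : 'I_n -> 'I_d -> R) (f : R) (f0 : 0 < f).

(** A matrix and its transpose have the same norm: for [z i = dotp (Y i) w], the square [dotp z z]
    equals [dotp w (comb Y z)], and the weight [f] absorbs half of it. *)
Lemma dual_bound : (forall z, dotp (comb Y z) (comb Y z) <= f * dotp z z) ->
  forall w, \sum_i dotp (Y i) w ^+ 2 <= f * dotp w w.
Proof.
move=> F1 w; pose z i := dotp (Y i) w.
have -> : \sum_i dotp (Y i) w ^+ 2 = dotp z z by rewrite sqr_dotp.
have E : dotp z z = dotp w (comb Y z).
  by rewrite dotp_comb; apply: eq_bigr => i _; rewrite (dotpC w).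
have := amgm_sum xpredT w (comb Y z) f0; rewrite -!sqr_dotp -/(dotp w (comb Y z)) -E.
have : dotp (comb Y z) (comb Y z) / f <= dotp z z by rewrite ler_pdivrMr // mulrC F1.
lra.
Qed.

End Duality.

Section RationalDensity.
Context (R : realType) (n d : nat) (Y : 'I_n -> 'I_d -> R).

Lemma dotpD_le m (u v : 'I_m -> R) (e : R) : 0 < e ->
  dotp (fun j => u j + v j) (fun j => u j + v j) <= (1 + e) * dotp u u + (1 + e^-1) * dotp v v.
Proof.
move=> e0; rewrite dotpDr !dotpDl (dotpC v u).
by have := amgm_sum xpredT u v e0; rewrite -!sqr_dotp -/(dotp u v); lra.
Qed.

(** A crude bound whose finiteness is what counts: it makes the supremum in [opnorm] finite and
    controls small perturbations of the argument. *)
Lemma comb_bound : exists2 F : R, 0 <= F & forall z, dotp (comb Y z) (comb Y z) <= F * dotp z z.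
Proof.
pose M := 1 + \sum_i dotp (Y i) (Y i).
have M0 : 0 < M by rewrite ltr_pwDl // sumr_ge0 // => i _; exact: dotp_ge0.
have YM i : dotp (Y i) (Y i) <= M.
  rewrite /M (bigD1 i) //=; have : 0 <= \sum_(j | j != i) dotp (Y j) (Y j).
    by apply: sumr_ge0 => j _; exact: dotp_ge0.
  lra.
exists (n%:R * M); first by rewrite mulr_ge0 // ltW.
move=> z; have cn : (#|[set: 'I_n]%SET| <= n)%N by rewrite cardsT card_ord.
have := energy_small YM z cn.
have e : comb Y (restr z [set: 'I_n]%SET) =1 comb Y z by apply: eq_comb => i; rewrite /restr finset.in_setT.
rewrite (eq_dotp e e) sqr_dotp; move/le_trans; apply; rewrite le_eqVlt (sqr_dotp z); apply/orP; left.
by apply/eqP; congr (_ * _); apply: eq_bigl => i; rewrite finset.in_setT.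
Qed.

(** By continuity the rational vectors suffice, which makes bounds on the norm countable
    conditions. *)
Lemma rational_density (C : R) : 0 <= C ->
  (forall q : 'I_n -> rat, let z i : R := ratr (q i) in
     dotp (comb Y z) (comb Y z) <= C * dotp z z) ->
  forall x, dotp x x = 1 -> dotp (comb Y x) (comb Y x) <= C.
Proof.
move=> C0 hq x x1; have [F F0 hF] := comb_bound.
have D0 : 0 < 7 * C + 2 * F + 1 by lra.
apply/ler_addgt0Pr => t t0.
(* The total error below is at most [(7 * C + 2 * F) * e], hence at most [t]. *)
pose e := Num.min 1 (t / (7 * C + 2 * F + 1)).
have e0 : 0 < e by rewrite lt_min ltr01 divr_gt0.
have e1 : e <= 1 by rewrite ge_min lexx.
have et : e * (7 * C + 2 * F + 1) <= t by rewrite -ler_pdivlMr // ge_min lexx orbT.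
have n1 : 0 < n.+1%:R :> R by rewrite ltr0n.
pose dl := e / n.+1%:R.
have dl0 : 0 < dl by rewrite divr_gt0.
have hr i : exists q : rat, `|x i - ratr q| <= dl.
  have lt : x i < x i + dl by rewrite ltrDl.
  have [q] := rat_in_itvoo lt; rewrite in_itv /= => /andP[q1 q2].
  by exists q; rewrite ler_norml; apply/andP; split; lra.
have [q hqx] := choice hr.
pose z i : R := ratr (q i).
pose u i := x i - z i.
have uu : dotp u u <= e ^+ 2.
  rewrite sqr_dotp; apply: le_trans (sum_card_le (c := dl ^+ 2) _) _.
    by move=> i _; rewrite -(real_normK (num_real (u i))) lerXn2r ?nnegrE ?(ltW dl0) //; exact: hqx.
  rewrite card_ord /dl expr_div_n mulrCA ler_piMr ?sqr_ge0 // ler_pdivrMr ?exprn_gt0 // mul1r.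
  by rewrite -natrX ler_nat -mulnn (leq_trans (leqnSn n)) // leq_pmulr.
have zz : dotp z z <= 1 + 3 * e.
  have zE : z =1 (fun i => x i + (- 1) * u i) by move=> i; rewrite /u; ring.
  rewrite (eq_dotp zE zE); apply: le_trans (dotpD_le _ _ e0) _.
  rewrite x1 dotpZl dotpZr; have ei : 0 < e^-1 by rewrite invr_gt0.
  have h1 : (1 + e^-1) * (-1 * (-1 * dotp u u)) <= (1 + e^-1) * e ^+ 2.
    rewrite !mulN1r opprK; apply: ler_wpM2l => //; by rewrite addr_ge0 // ltW.
  have h2 : (1 + e^-1) * e ^+ 2 = e ^+ 2 + e by field; rewrite gt_eqF.
  move: h1; rewrite h2; have : e ^+ 2 <= e by rewrite expr2 ler_piMl // ltW.
  lra.
have xE : comb Y x =1 (fun j => comb Y z j + comb Y u j).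
  by move=> j; rewrite -combD; apply: eq_comb => i; rewrite /u; ring.
rewrite (eq_dotp xE xE); apply: le_trans (dotpD_le _ _ e0) _.
have ei : 0 < e^-1 by rewrite invr_gt0.
have h1 : (1 + e^-1) * dotp (comb Y u) (comb Y u) <= (1 + e^-1) * (F * e ^+ 2).
  apply: ler_wpM2l; first by rewrite addr_ge0 // ltW.
  by apply: le_trans (hF u) _; exact: ler_wpM2l.
have h2 : (1 + e^-1) * (F * e ^+ 2) = F * (e ^+ 2 + e) by field; rewrite gt_eqF.
have h3 : (1 + e) * dotp (comb Y z) (comb Y z) <= (1 + e) * (C * (1 + 3 * e)).
  apply: ler_wpM2l; first by rewrite addr_ge0 // ltW.
  by apply: le_trans (hq q) _; exact: ler_wpM2l.
have e2 : e ^+ 2 <= e by rewrite expr2 ler_piMl // ltW.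
have h4 : F * (e ^+ 2 + e) <= F * (2 * e) by apply: ler_wpM2l => //; lra.
have h5 : (1 + e) * (C * (1 + 3 * e)) <= C * (1 + 7 * e).
  rewrite mulrCA; apply: ler_wpM2l => //; rewrite mulrDl mulrDr mulr1; move: e2; rewrite expr2; lra.
move: h1 h3; rewrite h2; move: et; lra.
Qed.

End RationalDensity.

Lemma dotp_delta (R : realFieldType) (n : nat) (i : 'I_n) (u : 'I_n -> R) :
  dotp u (fun j => (j == i)%:R) = u i.
Proof.
rewrite /dotp (bigD1 i) //= eqxx mulr1 big1 ?addr0 // => j /negbTE ->.
by rewrite mulr0.
Qed.

Section Opnorm.
Context (R : realType) (n : nat) (n0 : (0 < n)%N).

Definition col_of (z : 'I_n -> R) : 'cV[R]_n := \col_i z i.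

Lemma enorm_ge0 m (x : 'cV[R]_m) : 0 <= enorm x.
Proof. exact: sqrtr_ge0. Qed.

Lemma sqr_enorm m (x : 'cV[R]_m) : enorm x ^+ 2 = dotp (x ^~ 0) (x ^~ 0).
Proof.
by rewrite sqr_sqrtr ?sqr_dotp // sumr_ge0 // => i _; exact: sqr_ge0.
Qed.

Lemma enorm_col_of (z : 'I_n -> R) : enorm (col_of z) = Num.sqrt (dotp z z).
Proof. by rewrite /enorm sqr_dotp; congr Num.sqrt; apply: eq_bigr => i _; rewrite mxE. Qed.

Lemma enorm_cols_mx (y : 'I_n -> n.-tuple R) (x : 'cV[R]_n) :
  enorm (cols_mx y *m x) = Num.sqrt (dotp (comb (vecs y) (x ^~ 0)) (comb (vecs y) (x ^~ 0))).
Proof.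
rewrite /enorm sqr_dotp; congr Num.sqrt; apply: eq_bigr => j _; congr (_ ^+ 2).
by rewrite mxE; apply: eq_bigr => i _; rewrite mxE mulrC.
Qed.

Lemma opnorm_le (y : 'I_n -> n.-tuple R) (c : R) : 0 <= c ->
  (forall z, dotp z z = 1 -> dotp (comb (vecs y) z) (comb (vecs y) z) <= c ^+ 2) ->
  opnorm (cols_mx y) <= c.
Proof.
move=> c0 h; apply: ge_sup.
  pose i0 := Ordinal n0.
  exists (enorm (cols_mx y *m col_of (fun i => (i == i0)%:R))); exists (col_of (fun i => (i == i0)%:R)) => //=.
  by rewrite enorm_col_of dotp_delta eqxx sqrtr1.
move=> _ [x /= x1 <-]; rewrite enorm_cols_mx -(ger0_norm c0) -sqrtr_sqr ler_sqrt ?sqr_ge0 //.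
by apply: h; rewrite -sqr_enorm x1 expr1n.
Qed.

Lemma opnorm_bound (y : 'I_n -> n.-tuple R) : 0 <= opnorm (cols_mx y) /\
  forall z, dotp (comb (vecs y) z) (comb (vecs y) z) <= opnorm (cols_mx y) ^+ 2 * dotp z z.
Proof.
have [F F0 hF] := comb_bound (vecs y).
have ub : has_ubound [set enorm (cols_mx y *m x) | x in [set x : 'cV[R]_n | enorm x = 1]].
  exists (Num.sqrt F) => _ [x /= x1 <-]; rewrite enorm_cols_mx ler_sqrt //.
  by apply: le_trans (hF _) _; rewrite -sqr_enorm x1 expr1n mulr1.
have unit z : dotp z z = 1 -> Num.sqrt (dotp (comb (vecs y) z) (comb (vecs y) z)) <= opnorm (cols_mx y).
  move=> z1; apply: ub_le_sup => //; exists (col_of z) => /=.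
    by rewrite enorm_col_of z1 sqrtr1.
  rewrite enorm_cols_mx; congr Num.sqrt.
  by apply: eq_dotp; apply: eq_comb => i; rewrite mxE.
have op0 : 0 <= opnorm (cols_mx y).
  apply: le_trans (unit (fun i => (i == Ordinal n0)%:R) _); first exact: sqrtr_ge0.
  by rewrite dotp_delta eqxx.
split=> // z; have z0 := dotp_ge0 z.
(* A null vector cannot be normalised; the crude bound [F] covers it. *)
have [zn|zn] := eqVneq (dotp z z) 0.
  by apply: le_trans (hF z) _; rewrite zn !mulr0.
pose t := (Num.sqrt (dotp z z))^-1.
have s0 : 0 < Num.sqrt (dotp z z) by rewrite sqrtr_gt0 lt_def zn.
have t2 : t * t = (dotp z z)^-1 by rewrite -expr2 exprVn sqr_sqrtr.
have := unit (fun i => t * z i); rewrite dotpZl dotpZr mulrA t2 mulVf // => /(_ erefl).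
rewrite (eq_dotp (combZ _ _ _) (combZ _ _ _)) dotpZl dotpZr mulrA t2.
rewrite -[X in _ <= X](ger0_norm op0) -sqrtr_sqr ler_sqrt ?sqr_ge0 //.
by rewrite mulrC ler_pdivrMr // lt_def zn.
Qed.

End Opnorm.

(** * Measurability of the norm event *)

Section Measurability.
Context (R : realType) (n : nat) (n0 : (0 < n)%N) (d : measure_display) (T : measurableType d).

Lemma measurable_bigmax (I : Type) (s : seq I) (f : I -> T -> R) :
  (forall i, measurable_fun setT (f i)) ->
  measurable_fun setT (fun w => \big[Num.max/0]_(i <- s) f i w).
Proof.
move=> mf; elim: s => [|i s IH].
  by under eq_fun do rewrite big_nil; exact: measurable_cst.
by under eq_fun do rewrite big_cons; exact: measurable_maxr.
Qed.

Lemma measurable_enorm (y : T -> n.-tuple R) : measurable_fun setT y ->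
  measurable_fun setT (fun w => enorm (tuple_cV (y w))).
Proof.
move=> my.
have -> : (fun w => enorm (tuple_cV (y w))) = (fun w => (\sum_j tnth (y w) j ^+ 2) `^ 2^-1).
  apply/funext => w; rewrite powR12_sqrt; last by apply: sumr_ge0 => j _; exact: sqr_ge0.
  by rewrite /enorm; congr Num.sqrt; apply: eq_bigr => j _; rewrite mxE.
apply: (measurableT_comp (measurable_powR _)); apply: measurable_sum => j.
by apply: measurable_funX; exact: measurable_tuple_entry.
Qed.

(** The event is the intersection of the events [E q] over the countably many rational vectors [q];
    numbers that code no vector contribute [setT]. *)
Lemma measurable_opnorm_le (Y : 'I_n -> T -> n.-tuple R) (m : T -> R) :
  (forall i, measurable_fun setT (Y i)) -> measurable_fun setT m -> (forall w, 0 <= m w) ->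
  measurable [set w | opnorm (cols_mx (fun i => Y i w)) <= m w].
Proof.
move=> mY mm m0.
pose z (q : {ffun 'I_n -> rat}) (i : 'I_n) : R := ratr (q i).
pose E q := [set w | dotp (comb (vecs (Y ^~ w)) (z q)) (comb (vecs (Y ^~ w)) (z q))
   <= m w ^+ 2 * dotp (z q) (z q)].
pose E' k := if unpickle k is Some q then E q else setT.
have -> : [set w | opnorm (cols_mx (fun i => Y i w)) <= m w] = \bigcap_k E' k.
  apply/seteqP; split=> w /=.
    move=> h k _; rewrite /E'; case: (unpickle k) => [q|//]; rewrite /E /=.
    have [op0 hop] := opnorm_bound n0 (fun i => Y i w).
    apply: le_trans (hop _) _; apply: ler_wpM2r; first exact: dotp_ge0.
    by rewrite lerXn2r ?nnegrE.
  move=> h; apply: opnorm_le => // x x1.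
  apply: rational_density x1; first exact: sqr_ge0.
  move=> q; have := h (pickle [ffun i => q i]) Logic.I; rewrite /E' pickleK /E /=.
  have zq : z [ffun i => q i] =1 (fun i => ratr (q i)) by move=> i; rewrite /z ffunE.
  by rewrite (eq_dotp (eq_comb _ zq) (eq_comb _ zq)) (eq_dotp zq zq).
apply: bigcapT_measurable => k; rewrite /E'; case: (unpickle k) => [q|]; last exact: measurableT.
rewrite -[X in measurable X]setTI.
have mc j : measurable_fun setT (fun w => comb (vecs (Y ^~ w)) (z q) j) by exact: measurable_comb.
have m1 := measurable_dotp mc mc.
have m2 : measurable_fun setT (fun w => m w ^+ 2 * dotp (z q) (z q)).
  by apply: measurable_funM; [exact: measurable_funX|exact: measurable_cst].
exact: (measurable_fun_ler m1 m2 measurableT (Y := [set true])).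
Qed.

End Measurability.

(** * Choice of the constants and assembly of the exceptional events *)

Theorem theorem1p3 (R : realType) (p B : R) :
  2 < p -> 1 <= B ->
  exists (K1 : nat) (K2 : R),
  forall (n : nat), (K1 <= n)%N ->
  forall (d : measure_display) (T : measurableType d) (P : probability T R)
         (Y : 'I_n -> T -> n.-tuple R),
    (forall i, measurable_fun setT (Y i)) ->
    independent_family P Y ->
    identically_distributed P Y ->
    (* centered *)
    (forall i (j : 'I_n), (\int[P]_w (tnth (Y i w) j)%:E = 0)%E) ->
    (* isotropic: E Y Y^T = Id *)
    (forall i (j k : 'I_n),
        (\int[P]_w (tnth (Y i w) j * tnth (Y i w) k)%:E = (j == k)%:R%:E)%E) ->
    (* sup over the unit sphere of E |<Y_i, a>|^p is at most B *)
    (forall i (a : 'cV[R]_n), enorm a = 1 ->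
        (\int[P]_w (`| \sum_(j < n) tnth (Y i w) j * a j 0 | `^ p)%:E <= B%:E)%E) ->
    ((1 - 4 / n%:R)%:E <=
       P [set w | (opnorm (cols_mx (fun i => Y i w))
                  <= K2 * \big[Num.max/0]_(i < n) enorm (tuple_cV (Y i w)))%R])%E.
Proof.
move=> p2 B1.
have B0 : 0 <= B by exact: le_trans B1.
have [c rho4] := spread_exponent p2.
pose sig := spread_sig p; pose K := spread_K p B.
have sig02 : 0 <= sig < 2 by rewrite powR_ge0 spread_sig_lt2.
have K0 : 0 <= K by exact: powR_ge0.
pose EC := energy_const K sig c c.
pose dl := (4 * truncation_level p B)^-1.
have tau1 := truncation_level_ge1 p2 B1.
have dl01 : 0 < dl <= 1.
  have t1 : 1 <= 4 * truncation_level p B by move: tau1; lra.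
  have t0 := lt_le_trans ltr01 t1.
  by rewrite invr_gt0 t0 invf_le1.
(* The first bound on [n] puts [U] above the lowest peeling level, the second serves
   [geometric_decay]. The [10] is twice [1 + 4], from absorbing half of [op ^+ 2] and from
   [2 ^+ U <= 4 * m ^+ 2]. *)
exists (maxn (2 ^ (c + (c + 7))) (Num.truncn (4 / dl ^+ 2)).+1), (Num.sqrt (10 * EC)).
move=> n; rewrite geq_max => /andP[nc nd] d T P Y mY iY _ _ iso mom.
have n0 : (0 < n)%N by apply: leq_trans nc; rewrite expn_gt0.
have nR : 0 < n%:R :> R by rewrite ltr0n.
pose U := up_log 2 n.
have nU : (n <= 2 ^ U)%N by exact: up_logP.
have Un : (2 ^ U <= 2 * n)%N.
  have [n1|n1] := leqP n 1.
    by rewrite /U; have -> : n = 1%N by apply/eqP; rewrite eqn_leq n1.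
  have /andP[h _] := up_log_bounds (ltnSn 1) n1.
  have U0 : (0 < U)%N by rewrite up_log_gt0.
  by rewrite -(prednK U0) expnS leq_mul2l /= ltnW.
have cU : (c + (c + 7) <= U)%N by rewrite -(leq_exp2l _ _ (ltnSn 1)) (leq_trans nc).
have momY i (a : 'I_n -> R) : dotp a a = 1 ->
    (\int[P]_w (`|dotp (vecs (Y ^~ w) i) a| `^ p)%:E <= B%:E)%E.
  move=> a1; have := mom i (col_of a); rewrite enorm_col_of a1 sqrtr1 => /(_ erefl).
  apply: le_trans; rewrite le_eqVlt; apply/orP; left; apply/eqP; apply: eq_integral => w _.
  by congr (`| _ | `^ _)%:E; apply: eq_bigr => j _; rewrite mxE.
have Y2 i j : (\int[P]_w (tnth (Y i w) j ^+ 2)%:E = 1)%E.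
  by have := iso i j j; rewrite eqxx => <-; apply: eq_integral => w _; rewrite expr2.
have Yp i j : (\int[P]_w (`|tnth (Y i w) j| `^ p)%:E <= B%:E)%E.
  have := momY i (fun k => (k == j)%:R); rewrite dotp_delta eqxx => /(_ erefl).
  by under eq_integral do rewrite dotp_delta.
have [Bad1 [mB1 PB1 sB1]] := spread_whp p2 B0 rho4 nU mY iY momY.
have [Bad2 [mB2 PB2 sB2]] := long_vector_whp p2 B1 n0 mY iY Y2 Yp.
set Good := [set w | _].
have mGood : measurable Good.
  apply: measurable_opnorm_le => //.
    apply: measurable_funM; first exact: measurable_cst.
    by apply: measurable_bigmax => i; exact: measurable_enorm.
  move=> w; rewrite mulr_ge0 ?sqrtr_ge0 //; exact: bigmax_ge_id.
have bad : ~` Good `<=` Bad1 `|` Bad2.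
  move=> w nG; apply: contrapT => /not_orP[nB1 nB2]; apply: nG; rewrite /Good /=.
  have spr := sB1 w nB1; have [i0 hi0] := sB2 w nB2.
  set m := \big[Num.max/0]_(i < n) _.
  have m0 : 0 <= m by exact: bigmax_ge_id.
  have Yi i : dotp (vecs (Y ^~ w) i) (vecs (Y ^~ w) i) = enorm (tuple_cV (Y i w)) ^+ 2.
    by rewrite sqr_enorm; apply: eq_bigr => j _; rewrite mxE.
  have YM i : dotp (vecs (Y ^~ w) i) (vecs (Y ^~ w) i) <= m ^+ 2.
    by rewrite Yi lerXn2r ?nnegrE ?enorm_ge0 //; exact: le_bigmax.
  have Mn : n%:R / 2 <= m ^+ 2 by apply: le_trans hi0 _; rewrite -sqr_dotp; exact: YM.
  have M0 : 0 < m ^+ 2 by apply: lt_le_trans Mn; rewrite divr_gt0.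
  have [op0 F1] := opnorm_bound n0 (fun i => Y i w).
  set op := opnorm _ in op0 F1 *.
  (* The deterministic bound divides by [f = op ^+ 2], so the zero norm is treated apart. *)
  have [opz|opn] := eqVneq op 0; first by rewrite opz mulr_ge0 // sqrtr_ge0.
  have f0 : 0 < op ^+ 2 by rewrite exprn_gt0 // lt_def opn.
  have F2 := dual_bound f0 F1.
  (* The energy bound for [f = op ^+ 2] holds on the whole unit sphere, hence bounds [op ^+ 2]
     itself; as [op] is finite, half of it can be absorbed. *)
  have key : op ^+ 2 <= op ^+ 2 / 2 + EC * (m ^+ 2 + 2 ^+ U).
    have ub z : dotp z z = 1 -> dotp (comb (vecs (Y ^~ w)) z) (comb (vecs (Y ^~ w)) z)
        <= op ^+ 2 / 2 + EC * (m ^+ 2 + 2 ^+ U).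
      move=> z1; apply: (energy_le_const f0 M0 K0 sig02 F1 F2 YM (leqnn c) spr _ cU nU).
      by rewrite -sqr_dotp z1.
    have C0 : 0 <= op ^+ 2 / 2 + EC * (m ^+ 2 + 2 ^+ U).
      apply: le_trans (dotp_ge0 _) (ub (fun i => (i == i0)%:R) _).
      by rewrite dotp_delta eqxx.
    have := @opnorm_le _ _ n0 (fun i => Y i w) (Num.sqrt (op ^+ 2 / 2 + EC * (m ^+ 2 + 2 ^+ U))).
    rewrite sqrtr_ge0 sqr_sqrtr // => /(_ isT ub) h.
    by rewrite -(sqr_sqrtr C0) lerXn2r ?nnegrE ?sqrtr_ge0.
  have U4 : 2 ^+ U <= 4 * m ^+ 2.
    have : 2 ^+ U <= 2 * n%:R :> R by rewrite -natrX -natrM ler_nat.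
    by move: Mn; lra.
  (* Positivity follows from [key], whose left side is positive. *)
  have EC0 : 0 < EC.
    have : 0 < EC * (m ^+ 2 + 2 ^+ U) by lra.
    by rewrite pmulr_lgt0 // addr_gt0 // exprn_gt0.
  have : op ^+ 2 <= (Num.sqrt (10 * EC) * m) ^+ 2.
    rewrite exprMn sqr_sqrtr ?mulr_ge0 ?(ltW EC0) //.
    have := ler_wpM2l (ltW EC0) U4; move: key; lra.
  by rewrite ler_sqr ?nnegrE // mulr_ge0 // sqrtr_ge0.
have PC : (P (~` Good) <= (4 / n%:R)%:E)%E.
  apply: (@le_trans _ _ (P (Bad1 `|` Bad2))).
    by apply: le_measure; rewrite ?inE //; [exact: measurableC|exact: measurableU].
  apply: le_trans (measureU2 _ _ _) _ => //.
  (* Spreading fails with probability at most [2 / n], and all columns are short with probability at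
     most [1 / n]. *)
  apply: le_trans (leeD PB1 PB2) _; rewrite -EFinD lee_fin.
  have h1 : 2 / 4 ^+ U <= 2 / n%:R :> R.
    rewrite ler_pM2l // lef_pV2 ?posrE ?exprn_gt0 // -natrX ler_nat (leq_trans nU) //.
    by rewrite -[4%N]/(2 ^ 2)%N -expnM leq_exp2l // leq_pmull.
  have h2 : (1 - dl) ^+ n <= n%:R^-1.
    apply: geometric_decay => //; apply: le_trans (ltW (truncnS_gt _)) _.
    by rewrite ler_nat.
  have h3 : 0 <= n%:R^-1 :> R by rewrite invr_ge0 ltW.
  by move: h1 h2; rewrite /dl; lra.
have fG := fin_num_measure P _ mGood.
move: PC; rewrite probability_setC // -(fineK fG) -EFinB !lee_fin; lra.
Qed.
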